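(* Let $d\in\mathbb{N}$, $\tau=(\tau_j)_{j=1}^d\in(0,\infty)^d$, and let $f:\mathbb{R}^d\to\mathbb{R}$ admit a holomorphic extension $f:S_\tau\to\mathbb{C}$ such that for every $\beta\in\mathbb{R}^d$ with $0\le\beta\le\tau$ (componentwise) there exists $B(\beta)>0$ such that for all $x+\mathrm{i}y=(x_j+\mathrm{i}y_j)_{j=1}^d\in S_\beta$ $$|f(x+\mathrm{i}y)|\le B(\beta)\exp\left(\sum_{j=1}^d\left(\frac{x_j^2}{4}-2^{-1/2}|x_j|\Big(\beta_j^2-\frac12y_j^2\Big)^{1/2}\right)\right).$$ Then for every $\beta=(\beta_j)_{j=1}^d\in\times_{j=1}^d(0,\tau_j)$ there exists $C>0$ (depending on $\beta$ and $d$) such that for every $N\in\mathbb{N}$ there exists a ReLU neural network $\tilde f_N:\mathbb{R}^d\to\mathbb{R}$ such that $$\operatorname{size}(\tilde f_N)\le CN(1+\log(N)),\qquad \operatorname{depth}(\tilde f_N)\le CN^{\frac{3}{2d+7}}(1+\log(N))^2,$$ and $$\|f-\tilde f_N\|_{L^2(\mathbb{R}^d,\gamma_d)}\le C\exp\left(-2^{-\frac12}\,\delta(\beta)\,N^{\frac{1}{2d+7}}\right),$$ where $\delta(\beta):=\big(\prod_{j=1}^d\beta_j\big)^{1/d}$.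
   Context: $\mathbb{N}=\{1,2,\dots\}$. $\gamma_d$ is the standard Gaussian measure on $\mathbb{R}^d$, with Lebesgue density $(2\pi)^{-d/2}\exp(-\|y\|_2^2/2)$. For $\kappa\ge0$ the open complex strip is $S_\kappa:=\{z=x+\mathrm{i}y\in\mathbb{C}:|y|<\kappa\}$ (with $x,y\in\mathbb{R}$), and for $\beta=(\beta_j)_{j=1}^d$, $S_\beta:=S_{\beta_1}\times\cdots\times S_{\beta_d}\subset\mathbb{C}^d$. Neural networks: with $\sigma(x)=\max\{x,0\}$ (ReLU), applied componentwise, a ReLU neural network $\Phi:\mathbb{R}^{n_0}\to\mathbb{R}^{n_{L+1}}$ is a map represented as $\Phi=A_L\circ\sigma\circ\cdots\circ\sigma\circ A_0$ with affine maps $A_j(x)=W_jx+b_j$ (no skip connections). $\operatorname{depth}(\Phi)=L$ is the number of applications of $\sigma$, and $\operatorname{size}(\Phi)$ is the total number of nonzero entries of all weight matrices $W_j$ and bias vectors $b_j$. *)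

(* Defs.v *)
From HB Require Import structures.
From mathcomp Require Import all_boot all_order all_algebra.
From mathcomp Require Import all_classical all_reals all_analysis.
From mathcomp Require Import measurable_realfun complex.
Set Implicit Arguments.
Unset Strict Implicit.
Unset Printing Implicit Defensive.
Import Order.TTheory GRing.Theory Num.Theory.
Import numFieldNormedType.Exports.
Local Open Scope classical_set_scope.
Local Open Scope ring_scope.

(* [R[i]] packed as a numClosedFieldType: its topology and its structure of
   normed space over itself are then the canonical ones.  On the bare type
   [R[i]] they would not be inferred (there, scalars are taken in [R]). *)
Definition Cplx (R : realType) : numClosedFieldType := R[i].

Definition to_complex (R : realType) (d : nat) (x : 'cV[R]_d) : 'cV[Cplx R]_d :=
  \col_j (x j 0)%:C%C.

Definition re_part (R : realType) (d : nat) (z : 'cV[Cplx R]_d) : 'cV[R]_d :=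
  \col_j complex.Re (z j 0).

Definition im_part (R : realType) (d : nat) (z : 'cV[Cplx R]_d) : 'cV[R]_d :=
  \col_j complex.Im (z j 0).

Definition strip (R : realType) (kappa : R) : set (Cplx R) :=
  [set z | `|complex.Im z| < kappa].

Definition polystrip (R : realType) (d : nat) (beta : 'I_d -> R) :
    set 'cV[Cplx R]_d :=
  [set z | forall j, strip (beta j) (z j 0)].

(* [differentiable] is Frechet differentiability, with a [Cplx R]-linear
   differential. *)
Definition holomorphic_on (R : realType) (d : nat)
    (D : set 'cV[Cplx R]_d) (F : 'cV[Cplx R]_d -> Cplx R) : Prop :=
  forall z, D z -> differentiable F z.

(* MathComp-Analysis puts the product sigma-algebra on tuples, so measures on
   R^d are measures on [d.-tuple R]; [col_of_tuple] is the identification with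
   column vectors. *)
Definition col_of_tuple (R : realType) (d : nat) (t : d.-tuple R) : 'cV[R]_d :=
  \col_j tnth t j.

Section LebesgueTuple.
Context (R : realType).

Definition pair_cons (n : nat) (p : n.-tuple R * R) : n.+1.-tuple R :=
  [tuple of p.2 :: p.1].

Lemma measurable_pair_cons (n : nat) :
  measurable_fun [set: n.-tuple R * R] (@pair_cons n).
Proof. exact: (measurable_cons measurable_snd measurable_fst). Qed.

Section Cons.
Context (n : nat) (mu : {measure set (n.-tuple R) -> \bar R}).

Definition lebesgue_cons : set (n.+1.-tuple R) -> \bar R :=
  pushforward (mu \x (@lebesgue_measure R))%E (@pair_cons n).

Let lebesgue_cons0 : lebesgue_cons set0 = 0%E.
Proof. by rewrite /lebesgue_cons /pushforward preimage_set0 measure0. Qed.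

Let lebesgue_cons_ge0 A : (0 <= lebesgue_cons A)%E.
Proof. by rewrite /lebesgue_cons /pushforward measure_ge0. Qed.

Let lebesgue_cons_sigma_additive : semi_sigma_additive lebesgue_cons.
Proof.
move=> F mF tF mUF; rewrite /lebesgue_cons /pushforward preimage_bigcup.
have mpre B : measurable B -> measurable (@pair_cons n @^-1` B).
  by move=> mB; rewrite -[X in measurable X]setTI;
    exact: measurable_pair_cons.
apply: measure_semi_sigma_additive.
- by move=> k; exact: mpre.
- apply/trivIsetP => /= i j _ _ ij; rewrite -preimage_setI.
  by move/trivIsetP : tF => /(_ _ _ _ _ ij) ->//; rewrite preimage_set0.
- by rewrite -preimage_bigcup; exact: mpre.
Qed.

HB.instance Definition _ := isMeasure.Build _ _ _ lebesgue_cons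
  lebesgue_cons0 lebesgue_cons_ge0 lebesgue_cons_sigma_additive.

End Cons.

Fixpoint lebesgue_tuple (d : nat) : {measure set (d.-tuple R) -> \bar R} :=
  match d with
  | 0%N => @dirac _ _ [tuple] R
  | n.+1 => lebesgue_cons (lebesgue_tuple n)
  end.

End LebesgueTuple.

Section Gaussian.
Context (R : realType) (d : nat).

Definition gaussian_pdf (y : d.-tuple R) : R :=
  (2 * pi) `^ (- (d%:R / 2)) * expR (- (\sum_(j < d) tnth y j ^+ 2) / 2).

Definition gaussian (A : set (d.-tuple R)) : \bar R :=
  (\int[lebesgue_tuple R d]_(y in A) (gaussian_pdf y)%:E)%E.

Lemma gaussian_pdf_ge0 y : 0 <= gaussian_pdf y.
Proof. by rewrite mulr_ge0 ?powR_ge0 ?expR_ge0. Qed.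

Lemma measurable_gaussian_pdf : measurable_fun [set: d.-tuple R] gaussian_pdf.
Proof.
apply: measurable_funM => //; apply: measurableT_comp => //.
apply: measurable_funM => //; apply: measurableT_comp => //.
apply: measurable_sum => j; apply: measurable_funX; exact: measurable_tnth.
Qed.

Let gaussian0 : gaussian set0 = 0%E.
Proof. by rewrite /gaussian integral_set0. Qed.

Let gaussian_ge0 A : (0 <= gaussian A)%E.
Proof. by apply: integral_ge0 => y _; rewrite lee_fin gaussian_pdf_ge0. Qed.

Let gaussian_sigma_additive : semi_sigma_additive gaussian.
Proof.
move=> F mF tF mUF; rewrite /gaussian ge0_integral_bigcup//=.
- have := @is_cvg_nneseries _ (fun k => gaussian (F k)) xpredT 0; apply => k _ _.
  exact: gaussian_ge0.
- apply/measurable_EFinP; apply: (measurable_funS measurableT) => //.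
  exact: measurable_gaussian_pdf.
- by move=> y _; rewrite lee_fin gaussian_pdf_ge0.
Qed.

HB.instance Definition _ := isMeasure.Build _ _ _ gaussian
  gaussian0 gaussian_ge0 gaussian_sigma_additive.

End Gaussian.

Definition gaussian_L2 (R : realType) (d : nat) (g : 'cV[R]_d -> R) : \bar R :=
  ('N[@gaussian R d]_2%:E[(fun t => (g (col_of_tuple t))%:E)])%E.

Definition affine (R : realType) (m n : nat) (W : 'M[R]_(n, m)) (b : 'cV[R]_n)
    (x : 'cV[R]_m) : 'cV[R]_n :=
  W *m x + b.

Definition relu (R : realType) (n : nat) (x : 'cV[R]_n) : 'cV[R]_n :=
  map_mx (fun t : R => Num.max t 0) x.

(* [relu_net R n m] is the type of networks (architecture and weights) from
   R^m to R^n, listed from the input side: [Hidden W b net] represents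
   net \o relu \o (x |-> W x + b).  Hidden widths are positive. *)
Inductive relu_net (R : realType) (n : nat) : nat -> Type :=
| Output (m : nat) (W : 'M[R]_(n, m)) (b : 'cV[R]_n) : relu_net R n m
| Hidden (m k : nat) (W : 'M[R]_(k.+1, m)) (b : 'cV[R]_k.+1)
    (net : relu_net R n k.+1) : relu_net R n m.

Fixpoint realize (R : realType) (n m : nat) (net : relu_net R n m) :
    'cV[R]_m -> 'cV[R]_n :=
  match net with
  | Output _ W b => affine W b
  | Hidden _ _ W b net' => fun x => realize net' (relu (affine W b x))
  end.

Fixpoint net_depth (R : realType) (n m : nat) (net : relu_net R n m) : nat :=
  match net with
  | Output _ _ _ => 0%N
  | Hidden _ _ _ _ net' => (net_depth net').+1
  end.

Definition nb_nonzero (R : realType) (m n : nat) (A : 'M[R]_(m, n)) : nat :=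
  #|[set ij : 'I_m * 'I_n | A ij.1 ij.2 != 0]%SET|.

Fixpoint net_size (R : realType) (n m : nat) (net : relu_net R n m) : nat :=
  match net with
  | Output _ W b => (nb_nonzero W + nb_nonzero b)%N
  | Hidden _ _ W b net' => (nb_nonzero W + nb_nonzero b + net_size net')%N
  end.

Definition geometric_mean (R : realType) (d : nat) (beta : 'I_d -> R) : R :=
  (\prod_(j < d) beta j) `^ (d%:R^-1).

(* Main.v *)
From HB Require Import structures.
Require Import Defs.
From mathcomp Require Import all_boot all_order all_algebra.
From mathcomp Require Import all_classical all_reals all_analysis.
From mathcomp Require Import measurable_realfun complex ring lra zify.
Import Order.TTheory GRing.Theory Num.Theory.
Import numFieldNormedType.Exports.
Local Open Scope classical_set_scope.
Local Open Scope ring_scope.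

(* Only the rates in N matter: since C is arbitrary, it suffices to find c > 0 and
   networks of size O(n^(2d+3)) and depth O(n^3) with error O(exp(- c n)), and
   then take n of order N^(1/(2d+7)).

   Cut [-nh, nh]^d into cubes of a fixed side h, small with respect to tau, with a
   partition of unity by products of hat functions. On each cube f is within a
   relative error exp(- K n) of a polynomial of degree O(n) in each variable:
   Newton interpolation at distinct real nodes, one variable after the other. The
   divided differences decay geometrically because a holomorphic function is
   bounded at a real point by its values on the boundary of a square (Goursat and
   Cauchy). With distinct nodes the Newton quotients are merely continuous at the
   nodes, which all lie on one line, so no theorem on removable singularities is
   needed. Outside of the cubes the growth bound on f makes the weighted error
   exponentially small.

   Each term of the sum is a product of O(n) factors, computed sequentially by a
   network of constant width whose products are accurate up to exp(- O(n^2)), by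
   the expansion of x^2 in iterated tent maps. All terms have the same number of
   factors, so that their networks can be put in parallel. *)

(** * Integrals over segments *)

(** The cubes keep a fixed side because the growth bound and the weight exp(sum (x_j^2/4 - k |x_j|))
    share the quadratic part of their exponents: near a cube with centre of size O(n), the bound on
    F exceeds the weight by a factor exp(O(n)) only, and the geometric decay at degree K n absorbs
    it once K is large. For the tail, the bound on f has twice the linear term kept in the weight,
    and the surplus pays for the truncation. Network errors are absolute, while coefficients may
    reach exp(d n^2) on the outer cubes; this is why the products need accuracy exp(- O(n^2)), hence
    O(n^2) layers each. O(n) factors per term then give the depth, and O(n^d) cubes with O(n^d)
    terms each give the size. Both stay within the prescribed powers when n is any constant multiple
    of N^(1/(2d+7)), and choosing this multiple produces the prescribed rate delta(beta). Squares
    instead of discs reduce all contour integrals to real integrals over segments. *)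

Section segment_integral.
Context {R : realType}.
Notation mu := (@lebesgue_measure R).
Implicit Types (a b c k : R) (f g : R -> R).

Definition segment_integral a b f : R := \int[mu]_(x in `[a, b]) f x.

Definition continuous_on_segment a b f :=
  forall x, a <= x <= b -> {for x, continuous f}.

Lemma integrable_segment a b f : continuous_on_segment a b f ->
  mu.-integrable `[a, b] (EFin \o f).
Proof.
move=> cf; apply: continuous_compact_integrable; first exact: segment_compact.
apply: continuous_in_subspaceT => x /set_mem /=; rewrite in_itv/=; exact: cf.
Qed.

Lemma segment_integralB a b f g :
  continuous_on_segment a b f -> continuous_on_segment a b g ->
  segment_integral a b (fun x => f x - g x) =
  segment_integral a b f - segment_integral a b g.
Proof. by move=> cf cg; apply: RintegralB => //; exact: integrable_segment. Qed.

Lemma segment_integral_split a b c f : a <= b <= c ->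
  continuous_on_segment a c f ->
  segment_integral a c f = segment_integral a b f + segment_integral b c f.
Proof.
move=> /andP[ab bc] cf; have ifac := @integrable_segment a c f cf.
have := @Rintegral_itvB R f (BLeft a) (BRight c) b ifac.
rewrite !bnd_simp => /(_ ab bc) e; apply/eqP; rewrite addrC -subr_eq; apply/eqP.
rewrite /segment_integral e Rintegral_itv_obnd_cbnd//.
by apply: integrableS ifac => //; apply: subset_itvr; rewrite bnd_simp.
Qed.

Lemma segment_integral_le a b f k : a <= b -> continuous_on_segment a b f ->
  (forall x, a <= x <= b -> f x <= k) -> segment_integral a b f <= k * (b - a).
Proof.
move=> ab cf fk; rewrite (_ : k * _ = segment_integral a b (cst k)).
  apply: le_Rintegral => //.
  - exact: integrable_segment.
  - by apply: integrable_segment => x _; exact: cst_continuous.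
rewrite /segment_integral Rintegral_cst//; congr (_ * _).
suff : mu `[a, b] = (b - a)%:E by move/(congr1 fine).
rewrite lebesgue_measure_itv/= lte_fin.
by case: ltP => [//|ba]; have -> : a = b by [apply/eqP; rewrite eq_le ab]; rewrite subrr.
Qed.

Lemma eq_segment_integral a b f g : (forall x, f x = g x) ->
  segment_integral a b f = segment_integral a b g.
Proof. by move=> fg; congr segment_integral; apply/funext. Qed.

Lemma segment_integralN a b f : continuous_on_segment a b f ->
  segment_integral a b (fun x => - f x) = - segment_integral a b f.
Proof.
move=> cf; rewrite -mulN1r -RintegralZl//; last exact: integrable_segment.
by apply: eq_segment_integral => x; rewrite mulN1r.
Qed.

Lemma segment_integral_near_cst a b f k e : a <= b ->
  continuous_on_segment a b f ->
  (forall x, a <= x <= b -> `|f x - k| <= e) ->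
  `|segment_integral a b f - k * (b - a)| <= e * (b - a).
Proof.
move=> ab cf fk.
have h1 : segment_integral a b f <= (k + e) * (b - a).
  by apply: segment_integral_le => // x /fk; rewrite ler_norml => /andP[]; lra.
have h2 : segment_integral a b (fun x => - f x) <= (e - k) * (b - a).
  apply: segment_integral_le => // [x xab|x /fk].
    by apply: continuousN; exact: cf.
  by rewrite ler_norml => /andP[]; lra.
by rewrite segment_integralN// in h2; rewrite ler_norml; apply/andP; split; lra.
Qed.

End segment_integral.

(** * Goursat's theorem on squares *)

Section goursat.
Context {R : realType}.
Implicit Types (U V : R -> R -> R) (a c l e x y : R).

Definition plane_continuous U x0 y0 := forall e, 0 < e -> exists2 d, 0 < d &
  forall x y, `|x - x0| < d -> `|y - y0| < d -> `|U x y - U x0 y0| <= e.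

(** The differential is multiplication by a + ib in real coordinates; the error is measured in the
    l^1 norm of the displacement. *)
Definition cauchy_riemann U V x0 y0 := exists a b, forall e, 0 < e ->
  exists2 d, 0 < d & forall x y, `|x - x0| < d -> `|y - y0| < d ->
    `|U x y - U x0 y0 - (a * (x - x0) - b * (y - y0))| <=
      e * (`|x - x0| + `|y - y0|) /\
    `|V x y - V x0 y0 - (b * (x - x0) + a * (y - y0))| <=
      e * (`|x - x0| + `|y - y0|).

Definition in_square a c l x y := a <= x <= a + l /\ c <= y <= c + l.

(* The imaginary part of the contour integral of U + iV along the boundary of
   the square [a, a+l] x [c, c+l]. *)
Definition square_flux U V a c l :=
  segment_integral a (a + l) (fun x => V x c - V x (c + l)) +
  segment_integral c (c + l) (fun y => U (a + l) y - U a y).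

Lemma plane_continuous_slicex U x y :
  plane_continuous U x y -> {for x, continuous (U ^~ y)}.
Proof.
move=> cU; apply/cvgrPdist_le => e e0; have [d d0 H] := cU e e0.
apply/nbhs_ballP; exists d => // t; rewrite /ball/= => xt.
by rewrite distrC; apply: H; rewrite ?subrr ?normr0// distrC.
Qed.

Lemma plane_continuous_slicey U x y :
  plane_continuous U x y -> {for y, continuous (U x)}.
Proof.
move=> cU; apply/cvgrPdist_le => e e0; have [d d0 H] := cU e e0.
apply/nbhs_ballP; exists d => // t; rewrite /ball/= => xt.
by rewrite distrC; apply: H; rewrite ?subrr ?normr0// distrC.
Qed.

Definition continuous_on_square U a c l :=
  forall x y, in_square a c l x y -> plane_continuous U x y.

Lemma continuous_on_slicex U a c l y : c <= y <= c + l ->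
  continuous_on_square U a c l -> continuous_on_segment a (a + l) (U ^~ y).
Proof. by move=> cy cU x ax; apply: plane_continuous_slicex; exact: cU. Qed.

Lemma continuous_on_slicey U a c l x : a <= x <= a + l ->
  continuous_on_square U a c l -> continuous_on_segment c (c + l) (U x).
Proof. by move=> ax cU y cy; apply: plane_continuous_slicey; exact: cU. Qed.

Lemma square_fluxE U V a c l : 0 <= l ->
  continuous_on_square U a c l -> continuous_on_square V a c l ->
  square_flux U V a c l =
  segment_integral a (a + l) (V ^~ c) - segment_integral a (a + l) (V ^~ (c + l))
  + segment_integral c (c + l) (U (a + l)) - segment_integral c (c + l) (U a).
Proof.
move=> l0 cU cV; rewrite /square_flux !segment_integralB ?addrA//.
- by apply: continuous_on_slicey cU; lra.
- by apply: continuous_on_slicey cU; lra.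
- by apply: continuous_on_slicex cV; lra.
- by apply: continuous_on_slicex cV; lra.
Qed.

Lemma sub_square a c l a' c' l' :
  a <= a' -> a' + l' <= a + l -> c <= c' -> c' + l' <= c + l ->
  forall x y, in_square a' c' l' x y -> in_square a c l x y.
Proof. by move=> ? ? ? ? x y [? ?]; split; lra. Qed.

Lemma square_flux_subdivide U V a c l : 0 <= l ->
  continuous_on_square U a c l -> continuous_on_square V a c l ->
  let h := l / 2 in
  square_flux U V a c l =
  square_flux U V a c h + square_flux U V (a + h) c h +
  square_flux U V a (c + h) h + square_flux U V (a + h) (c + h) h.
Proof.
move=> l0 cU cV h; have h0 : 0 <= h by rewrite /h; lra.
have cS W a' c' : a <= a' -> a' + h <= a + l -> c <= c' -> c' + h <= c + l ->
    continuous_on_square W a c l -> continuous_on_square W a' c' h.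
  by move=> *; move=> x y /(@sub_square a c l a' c' h) xy; auto.
rewrite !square_fluxE//; try (by apply: cS => //; rewrite /h; lra).
have -> : a + h + h = a + l by rewrite /h; lra.
have -> : c + h + h = c + l by rewrite /h; lra.
have sx y : c <= y <= c + l -> segment_integral a (a + l) (V ^~ y) =
    segment_integral a (a + h) (V ^~ y) + segment_integral (a + h) (a + l) (V ^~ y).
  move=> cy; apply: segment_integral_split; first by rewrite /h; lra.
  exact: continuous_on_slicex cV.
have sy x : a <= x <= a + l -> segment_integral c (c + l) (U x) =
    segment_integral c (c + h) (U x) + segment_integral (c + h) (c + l) (U x).
  move=> ax; apply: segment_integral_split; first by rewrite /h; lra.
  exact: continuous_on_slicey cU.
rewrite (sx c) ?(sx (c + l)) ?(sy a) ?(sy (a + l)); try lra.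
Qed.

(** Opposite sides are paired: one pair contributes about - k l and the other about k l, which
    cancel. The Cauchy-Riemann equations supply a common k in [square_flux_at_cr]; mere continuity
    supplies k = 0. *)
Lemma square_flux_near_cst U V a c l k e : 0 <= l ->
  continuous_on_square U a c l -> continuous_on_square V a c l ->
  (forall x, a <= x <= a + l -> `|V x c - V x (c + l) + k| <= e) ->
  (forall y, c <= y <= c + l -> `|U (a + l) y - U a y - k| <= e) ->
  `|square_flux U V a c l| <= 2 * e * l.
Proof.
move=> l0 cU cV hV hU.
have ch : continuous_on_segment a (a + l) (fun x => V x c - V x (c + l)).
  by move=> x xx; apply: continuousB; apply: continuous_on_slicex cV _ xx => //; lra.
have cv : continuous_on_segment c (c + l) (fun y => U (a + l) y - U a y).
  by move=> x xx; apply: continuousB; apply: continuous_on_slicey cU _ xx => //; lra.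
have a0 : a <= a + l by lra. have c0 : c <= c + l by lra.
have := @segment_integral_near_cst _ _ _ _ (- k) e a0 ch.
have := @segment_integral_near_cst _ _ _ _ k e c0 cv hU.
have -> : c + l - c = l by lra. have -> : a + l - a = l by lra.
rewrite /square_flux => h1 h2.
have {}h2 : `|segment_integral a (a + l) (fun x => V x c - V x (c + l)) + k * l| <= e * l.
  by rewrite -[k * l]opprK -mulNr; apply: h2 => x /hV; rewrite opprK.
move: h1 h2; rewrite !ler_norml => /andP[? ?] /andP[? ?]; apply/andP; split; lra.
Qed.

Lemma square_flux_at_cr U V x0 y0 e : 0 < e -> cauchy_riemann U V x0 y0 ->
  exists2 d, 0 < d & forall a c l, 0 < l < d -> in_square a c l x0 y0 ->
  continuous_on_square U a c l -> continuous_on_square V a c l ->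
  `|square_flux U V a c l| <= e * l ^+ 2.
Proof.
(* With e/8, each value is within e/8 * 2l of its affine part, each difference across the square
   within e/2 * l, and the flux within 2 * (e/2 * l) * l. *)
move=> e0 [al [be H]]; have e8 : 0 < e / 8 by lra.
have [d d0 {}H] := H _ e8; exists d => // a c l ld [xl yl] cU cV.
have -> : e * l ^+ 2 = 2 * (e / 2 * l) * l by rewrite expr2; lra.
have dst x y : in_square a c l x y -> `|x - x0| <= l /\ `|y - y0| <= l.
  by move=> [? ?]; rewrite !ler_norml; split; apply/andP; split; lra.
have {}H x y : in_square a c l x y ->
    `|U x y - U x0 y0 - (al * (x - x0) - be * (y - y0))| <= e / 4 * l /\
    `|V x y - V x0 y0 - (be * (x - x0) + al * (y - y0))| <= e / 4 * l.
  move=> /dst[dx dy]; have [||h1 h2] := H x y; try lra.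
  have hl : e / 8 * (`|x - x0| + `|y - y0|) <= e / 4 * l.
    by apply: le_trans (_ : e / 8 * (l + l) <= _); [apply: ler_wpM2l; lra|lra].
  by split; [exact: le_trans h1 _|exact: le_trans h2 _].
apply: (@square_flux_near_cst _ _ _ _ _ (al * l)) => //; first lra.
- move=> x xx; have [|_] := H x c; first by rewrite /in_square; lra.
  have [|_] := H x (c + l); first by rewrite /in_square; lra.
  by rewrite !ler_norml => /andP[? ?] /andP[? ?]; apply/andP; split; lra.
- move=> y yy; have [|+ _] := H a y; first by rewrite /in_square; lra.
  have [|+ _] := H (a + l) y; first by rewrite /in_square; lra.
  by rewrite !ler_norml => /andP[? ?] /andP[? ?]; apply/andP; split; lra.
Qed.

Lemma square_flux_at_continuous U V x0 y0 e : 0 < e ->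
  plane_continuous U x0 y0 -> plane_continuous V x0 y0 ->
  exists2 d, 0 < d & forall a c l, 0 < l < d -> in_square a c l x0 y0 ->
  continuous_on_square U a c l -> continuous_on_square V a c l ->
  `|square_flux U V a c l| <= e * l.
Proof.
move=> e0 hU hV; have e4 : 0 < e / 4 by lra.
have [d1 d10 {}hU] := hU _ e4; have [d2 d20 {}hV] := hV _ e4.
exists (Num.min d1 d2); first by rewrite lt_min d10.
move=> a c l; rewrite lt_min => /and3P[l0 ld1 ld2] [xl yl] cU cV.
have -> : e * l = 2 * (e / 2) * l by lra.
have dst x y : in_square a c l x y -> `|x - x0| <= l /\ `|y - y0| <= l.
  by move=> [? ?]; rewrite !ler_norml; split; apply/andP; split; lra.
have {}hU x y : in_square a c l x y -> `|U x y - U x0 y0| <= e / 4.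
  by move=> /dst[dx dy]; apply: hU; lra.
have {}hV x y : in_square a c l x y -> `|V x y - V x0 y0| <= e / 4.
  by move=> /dst[dx dy]; apply: hV; lra.
apply: (@square_flux_near_cst _ _ _ _ _ 0) => //; first lra.
- move=> x xx; rewrite addr0.
  have /hV : in_square a c l x c by split; lra.
  have /hV : in_square a c l x (c + l) by split; lra.
  by rewrite !ler_norml => /andP[? ?] /andP[? ?]; apply/andP; split; lra.
- move=> y yy; rewrite subr0.
  have /hU : in_square a c l a y by split; lra.
  have /hU : in_square a c l (a + l) y by split; lra.
  by rewrite !ler_norml => /andP[? ?] /andP[? ?]; apply/andP; split; lra.
Qed.

(** The boolean acts as a multiplicity: the second term is l if the line y = y0 meets the square and
    0 otherwise. When the line does not cross the interior, it meets at most two of the four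
    quarters, whose sides add up to l; so the mass of the quarters does not exceed that of the
    square. *)
Definition flux_mass (y0 a c l : R) := l ^+ 2 + l *+ (c <= y0 <= c + l)%R.

(* Continuity suffices on the line y = y0, because a square touching that line
   carries a mass of order l rather than l^2. *)
Lemma goursat U V y0 a c l : 0 < l -> (y0 <= c) || (c + l <= y0) ->
  continuous_on_square U a c l -> continuous_on_square V a c l ->
  (forall x y, in_square a c l x y -> y != y0 -> cauchy_riemann U V x y) ->
  square_flux U V a c l = 0.
Proof.
move=> l0 y0c cU cV dUV.
suff H e : 0 < e -> `|square_flux U V a c l| <= e * flux_mass y0 a c l.
  apply/eqP; rewrite -normr_le0; apply/ler_addgt0Pl => e e0; rewrite addr0.
  have m0 : 0 < flux_mass y0 a c l.
    by rewrite /flux_mass ltr_pwDl ?exprn_gt0// mulrn_wge0// ltW.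
  have := H (e / flux_mass y0 a c l) (divr_gt0 e0 m0).
  by rewrite divfK// gt_eqF.
move=> e0; rewrite leNgt; apply/negP => bad0.
(* Bisection: by comparison of masses, a square whose flux is too large has a quarter whose flux is
   too large. *)
pose inv (s : R * R * R) := [/\ 0 < s.2,
  (y0 <= s.1.2) || (s.1.2 + s.2 <= y0),
  a <= s.1.1 /\ s.1.1 + s.2 <= a + l, c <= s.1.2 /\ s.1.2 + s.2 <= c + l &
  e * flux_mass y0 s.1.1 s.1.2 s.2 < `|square_flux U V s.1.1 s.1.2 s.2|].
have cS W a' c' l' : continuous_on_square W a c l ->
    a <= a' /\ a' + l' <= a + l -> c <= c' /\ c' + l' <= c + l ->
    continuous_on_square W a' c' l'.
  by move=> cW [? ?] [? ?] x y /(@sub_square a c l a' c' l') xy; auto.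
pose child (s s' : R * R * R) := [/\ s'.2 = s.2 / 2,
  s.1.1 <= s'.1.1 <= s.1.1 + s.2 / 2 & s.1.2 <= s'.1.2 <= s.1.2 + s.2 / 2].
have step s : inv s -> exists s', inv s' /\ child s s'.
  case: s => [[a1 c1] l1]; rewrite /inv /child/= => -[l10 nc [a1l a1r] [c1l c1r]].
  rewrite square_flux_subdivide ?(ltW l10)//; last 2 first.
    exact: cS cU _ _. exact: cS cV _ _.
  set h := l1 / 2; have h0 : 0 < h by rewrite /h; lra.
  have l1h : l1 = h + h by rewrite /h; lra.
  move=> bad; apply: contrapT => none.
  have good a2 c2 : a1 <= a2 <= a1 + h -> c1 <= c2 <= c1 + h ->
      (y0 <= c2) || (c2 + h <= y0) ->
      `|square_flux U V a2 c2 h| <= e * flux_mass y0 a2 c2 h.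
    move=> a12 c12 nc2; rewrite leNgt; apply/negP => bad2; apply: none.
    by exists (a2, c2, h); split => //; split=> //=; split; lra.
  have nc1 : (y0 <= c1) || (c1 + h <= y0).
    by case/orP: nc => ?; apply/orP; [left|right]; lra.
  have nc2 : (y0 <= c1 + h) || (c1 + h + h <= y0).
    by case/orP: nc => ?; apply/orP; [left|right]; lra.
  have g1 := good a1 c1 ltac:(lra) ltac:(lra) nc1.
  have g2 := good (a1 + h) c1 ltac:(lra) ltac:(lra) nc1.
  have g3 := good a1 (c1 + h) ltac:(lra) ltac:(lra) nc2.
  have g4 := good (a1 + h) (c1 + h) ltac:(lra) ltac:(lra) nc2.
  have : flux_mass y0 a1 c1 h + flux_mass y0 (a1 + h) c1 h +
      flux_mass y0 a1 (c1 + h) h + flux_mass y0 (a1 + h) (c1 + h) h <=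
      flux_mass y0 a1 c1 l1.
    rewrite /flux_mass l1h.
    have -> : (c1 <= y0 <= c1 + (h + h)) =
        (c1 <= y0 <= c1 + h) || (c1 + h <= y0 <= c1 + h + h).
      by apply/idP/idP; case/orP: nc => ?; lra.
    have : ~~ ((c1 <= y0 <= c1 + h) && (c1 + h <= y0 <= c1 + h + h)).
      by apply/negP => /andP[? ?]; case/orP: nc => ?; lra.
    by case: (c1 <= y0 <= c1 + h); case: (c1 + h <= y0 <= c1 + h + h) => //= _;
      rewrite ?mulr1n ?mulr0n !expr2; lra.
  rewrite -(ler_pM2l e0) => sm; move: bad; apply/negP; rewrite -leNgt.
  apply: (le_trans _ sm); clear sm.
  have n1 := ler_normD (square_flux U V a1 c1 h) (square_flux U V (a1 + h) c1 h).
  have n2 := ler_normD (square_flux U V a1 c1 h + square_flux U V (a1 + h) c1 h)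
    (square_flux U V a1 (c1 + h) h).
  apply: le_trans (ler_normD _ _) _; lra.
pose T := {s | inv s}.
have inv0 : inv (a, c, l) by split.
have /choice[f fP] : forall s : T, exists s' : T, child (sval s) (sval s').
  by case=> s si; have [s' [s'i cs]] := step s si; exists (exist _ s' s'i).
pose sq n : R * R * R := sval (iter n f (exist _ _ inv0)).
have sqi n : inv (sq n) by rewrite /sq; case: (iter _ _ _).
have sqS n : child (sq n) (sq n.+1) by exact: fP.
have sql n : (sq n).2 = l / 2 ^+ n.
  elim: n => [|n IH]; first by rewrite /= expr0 divr1.
  by have [-> _ _] := sqS n; rewrite IH exprSr invfM mulrA.
(* Both coordinates are treated alike: the intervals from p to p plus the side are nested, and the
   supremum of their left ends lies in all of them. *)
have nested (p : R * R * R -> R) :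
    (forall n, p (sq n) <= p (sq n.+1) <= p (sq n) + (sq n).2 / 2) ->
    exists z, forall n, p (sq n) <= z <= p (sq n) + (sq n).2.
  move=> pS.
  have mono n k : p (sq n) <= p (sq (n + k)%N).
    elim: k => [|k IH]; first by rewrite addn0.
    by rewrite addnS; apply: le_trans IH _; have /andP[] := pS (n + k)%N.
  have anti n k : p (sq (n + k)%N) + (sq (n + k)%N).2 <= p (sq n) + (sq n).2.
    elim: k => [|k IH]; first by rewrite addn0.
    apply: le_trans IH; rewrite addnS; have [-> _ _] := sqS (n + k)%N.
    by have := pS (n + k)%N; lra.
  have bnd n k : p (sq n) <= p (sq k) + (sq k).2.
    have pos j : 0 < (sq j).2 by have [] := sqi j.
    have [nk|kn] := leqP n k.
      by rewrite -(subnKC nk); have := mono n (k - n)%N; have := pos (n + (k - n))%N; lra.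
    rewrite -(subnKC (ltnW kn)); have := anti k (n - k)%N.
    by have := pos (k + (n - k))%N; lra.
  have hs : has_sup (range (p \o sq)).
    split; first by exists (p (sq 0%N)); exists 0%N.
    by exists (p (sq 0%N) + (sq 0%N).2) => _ [n _ <-]; exact: bnd.
  exists (sup (range (p \o sq))) => n; apply/andP; split.
    by apply: sup_upper_bound => //; exists n.
  by apply: ge_sup; [case: hs|move=> _ [k _ <-]; exact: bnd].
have [x xP] := nested (fun s => s.1.1) (fun n => let: And3 _ h _ := sqS n in h).
have [y yP] := nested (fun s => s.1.2) (fun n => let: And3 _ _ h := sqS n in h).
have small d : 0 < d -> exists n, (sq n).2 < d.
  move=> d0; have := @cvg_geometric R l (2^-1).
  rewrite ger0_norm ?invr_ge0// invf_lt1// ltr1n => /(_ isT).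
  move=> /cvgrPdist_lt/(_ d d0)[n _ /(_ n (leqnn n))].
  rewrite sub0r normrN /geometric/= exprVn -sql ger0_norm; first by exists n.
  by have [/ltW] := sqi n.
have sqxy n : in_square (sq n).1.1 (sq n).1.2 (sq n).2 x y by split.
have xyin : in_square a c l x y := sqxy 0%N.
(* If the limit point is on the line, small squares around it touch the line, and continuity bounds
   the flux by e * l, at most e times the mass. Otherwise the bound e * l^2 is available. *)
have [yy0|yy0] := eqVneq y y0.
  have [d d0 H] := @square_flux_at_continuous U V _ _ _ e0 (cU _ _ xyin) (cV _ _ xyin).
  have [n nd] := small d d0; have [n0 _ an cn] := sqi n.
  apply/negP; rewrite -leNgt.
  have := H (sq n).1.1 (sq n).1.2 (sq n).2; rewrite n0 nd => /(_ isT (sqxy n)).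
  move=> /(_ (cS _ _ _ _ cU an cn) (cS _ _ _ _ cV an cn)) /le_trans; apply.
  rewrite ler_pM2l// /flux_mass -yy0; have [_ ->] := sqxy n.
  by rewrite mulr1n lerDr sqr_ge0.
have [d d0 H] := @square_flux_at_cr U V _ _ _ e0 (dUV _ _ xyin yy0).
have [n nd] := small d d0; have [n0 _ an cn] := sqi n.
apply/negP; rewrite -leNgt.
have := H (sq n).1.1 (sq n).1.2 (sq n).2; rewrite n0 nd => /(_ isT (sqxy n)).
move=> /(_ (cS _ _ _ _ cU an cn) (cS _ _ _ _ cV an cn)) /le_trans; apply.
by rewrite ler_pM2l// /flux_mass lerDl mulrn_wge0// ltW.
Qed.

End goursat.

(** * Complex differentiability *)

Section complex_modulus.
Context {R : realType}.
Notation C := (Cplx R).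
Implicit Types (z w : C) (g : C -> C).

(** The norm of [Cplx R] takes values in [Cplx R]; this is its real counterpart, to which real
    arithmetic applies. *)
Definition cmod z : R := Normc.normc z.

Lemma normC_cmod z : `|z| = (cmod z)%:C%C. Proof. by []. Qed.

Lemma cmodE z : cmod z = Num.sqrt (complex.Re z ^+ 2 + complex.Im z ^+ 2).
Proof. by case: z. Qed.

Lemma sqr_cmod z : cmod z ^+ 2 = complex.Re z ^+ 2 + complex.Im z ^+ 2.
Proof. by rewrite cmodE sqr_sqrtr// addr_ge0// sqr_ge0. Qed.

Lemma cmod_ge0 z : 0 <= cmod z.
Proof. by rewrite cmodE sqrtr_ge0. Qed.

Lemma cmodM z w : cmod (z * w) = cmod z * cmod w.
Proof. exact: Normc.normcM. Qed.

Lemma cmodV z : cmod z^-1 = (cmod z)^-1.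
Proof. exact: Normc.normcV. Qed.

Lemma cmod0 : cmod 0 = 0.
Proof. by rewrite cmodE /= expr0n addr0 sqrtr0. Qed.

Lemma cmod_eq0 z : (cmod z == 0) = (z == 0).
Proof.
by apply/eqP/eqP => [/Normc.eq0_normc//|->]; exact: cmod0.
Qed.

Lemma cmod_gt0 z : (0 < cmod z) = (z != 0).
Proof. by rewrite lt_def cmod_ge0 andbT cmod_eq0. Qed.

Lemma cmodD z w : cmod (z + w) <= cmod z + cmod w.
Proof. exact: le_normcD. Qed.

Lemma cmodN z : cmod (- z) = cmod z.
Proof. exact: normcN. Qed.

Lemma cmodB z w : cmod (z - w) <= cmod z + cmod w.
Proof. by rewrite -(cmodN w) cmodD. Qed.

Lemma cmod_Re z : `|complex.Re z| <= cmod z.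
Proof. by rewrite cmodE -sqrtr_sqr ler_wsqrtr// lerDl sqr_ge0. Qed.

Lemma cmod_Im z : `|complex.Im z| <= cmod z.
Proof. by rewrite cmodE -sqrtr_sqr ler_wsqrtr// lerDr sqr_ge0. Qed.

Lemma cmod_le_ReIm z : cmod z <= `|complex.Re z| + `|complex.Im z|.
Proof.
rewrite -ler_sqr ?nnegrE ?cmod_ge0 ?addr_ge0// sqr_cmod sqrrD !real_normK ?num_real//.
by rewrite lerD2r lerDl mulrn_wge0// mulr_ge0.
Qed.

Lemma cmod_real (r : R) : cmod r%:C%C = `|r|.
Proof. by rewrite cmodE /= expr0n addr0 sqrtr_sqr. Qed.

Lemma gtC0_real (e : C) : 0 < e -> exists2 r : R, 0 < r & e = r%:C%C.
Proof.
by case: e => a b; rewrite ltcE /= => /andP[/eqP -> a0]; exists a.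
Qed.

Lemma nbhs_cmodP w (A : set C) :
  nbhs w A <-> exists2 d : R, 0 < d & forall v, cmod (v - w) < d -> A v.
Proof.
split=> [/nbhs_ballP[e /gtC0_real[d d0 ->] dA]|[d d0 dA]].
  exists d => // v vd; apply: dA; rewrite -ball_normE /=.
  by rewrite normC_cmod ltcR -cmodN opprB.
apply/nbhs_ballP; exists d%:C%C; first by rewrite /= ltcR.
move=> v; rewrite -ball_normE /= normC_cmod ltcR -cmodN opprB; exact: dA.
Qed.

Lemma continuous_cmodP g w : {for w, continuous g} <->
  forall e : R, 0 < e -> exists2 d : R, 0 < d &
    forall v, cmod (v - w) < d -> cmod (g v - g w) <= e.
Proof.
split=> [/cvgrPdist_le H e e0|H].
  have /H/nbhs_cmodP[d d0 dP] : 0 < (e%:C%C : C) by rewrite ltcR.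
  by exists d => // v /dP; rewrite normC_cmod lecR -cmodN opprB.
apply/(@cvgrPdist_le _ _ _ (nbhs w) _ g (g w)) => e /gtC0_real[r /H[d d0 dP] ->].
apply/nbhs_cmodP; exists d => // v /dP.
by rewrite normC_cmod lecR -cmodN opprB.
Qed.

Lemma differentiable_cmod g w : differentiable g w -> exists l : C,
  forall e : R, 0 < e -> exists2 d : R, 0 < d &
    forall v, cmod (v - w) < d -> cmod (g v - g w - l * (v - w)) <= e * cmod (v - w).
Proof.
move=> /derivable1_diffP dg; exists ('D_1 g w) => e e0.
move/cvgrPdist_le : dg => /(_ (e%:C%C : C)).
rewrite ltcR => /(_ e0); rewrite near_withinE => /nbhs_cmodP[d d0 dP].
exists d => // v vw; have [->|vnw] := eqVneq v w.
  by rewrite !subrr mulr0 subr0 cmod0 mulr0.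
have := dP (v - w); rewrite subr0 subr_eq0 => /(_ vw vnw).
rewrite normC_cmod lecR /= scaler1 subrK => le_e.
have vw0 : v - w != 0 by rewrite subr_eq0.
(* The first-order error is the error of the difference quotient times w - v. *)
rewrite (_ : _ - _ - _ = (lim ((fun h => h^-1 *: ((g \o shift w) h%:A - g w)) @ 0^')
  - (v - w)^-1 *: (g v - g w)) * (w - v)).
  by rewrite cmodM -[X in _ <= e * X]cmodN opprB ler_wpM2r ?cmod_ge0.
rewrite -(opprB v w) mulrN mulrBl opprB; congr (_ - _).
by rewrite /GRing.scale/= mulrAC mulVf// mul1r.
Qed.

Lemma plane_continuous_cmod g (x y : R) :
  {for (x +i* y)%C : C, continuous g} ->
  plane_continuous (fun s t => complex.Re (g (s +i* t)%C)) x y /\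
  plane_continuous (fun s t => complex.Im (g (s +i* t)%C)) x y.
Proof.
move/continuous_cmodP => H.
have {}H e : 0 < e -> exists2 d, 0 < d & forall s t, `|s - x| < d -> `|t - y| < d ->
    cmod (g (s +i* t)%C - g (x +i* y)%C) <= e.
  move=> /H[d d0 dP]; exists (d / 2) => [|s t sd td]; first by rewrite divr_gt0.
  apply: dP; apply: le_lt_trans (cmod_le_ReIm _) _ => /=; lra.
split=> e /H[d d0 dP]; exists d => // s t sd td.
  by apply: le_trans (dP s t sd td); apply: le_trans (cmod_Re _); rewrite raddfB.
by apply: le_trans (dP s t sd td); apply: le_trans (cmod_Im _); rewrite raddfB.
Qed.

Lemma cauchy_riemann_differentiable g (x y : R) :
  differentiable g ((x +i* y)%C : C) ->
  cauchy_riemann (fun s t => complex.Re (g (s +i* t)%C))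
                 (fun s t => complex.Im (g (s +i* t)%C)) x y.
Proof.
move/differentiable_cmod => [[a b] H]; exists a, b => e e0; have [d d0 dP] := H e e0.
exists (d / 2) => [|s t sd td]; first by rewrite divr_gt0.
have st : cmod ((s +i* t)%C - (x +i* y)%C) <= `|s - x| + `|t - y|.
  exact: cmod_le_ReIm.
have std : cmod ((s +i* t)%C - (x +i* y)%C) < d by lra.
have {dP std} := le_trans (dP _ std) (ler_wpM2l (ltW e0) st).
case: (g (s +i* t)%C) (g (x +i* y)%C) => [u v] [u0 v0] est.
have h1 := le_trans (cmod_Re _) est; have h2 := le_trans (cmod_Im _) est.
by split=> //; rewrite [b * _ + _]addrC.
Qed.

Definition centred_square (a : R) (z : C) :=
  `|complex.Re z| <= a /\ `|complex.Im z| <= a.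

Definition square_boundary (a : R) (z : C) :=
  centred_square a z /\ (`|complex.Re z| = a \/ `|complex.Im z| = a).

(** The real axis cuts the square in the middle. Each of the four quarters has it along one edge,
    which is the situation of [goursat] with y0 = 0. *)
Lemma goursat_centred a g : 0 < a ->
  (forall z, centred_square a z -> {for z, continuous g}) ->
  (forall z, centred_square a z -> complex.Im z != 0 -> differentiable g z) ->
  square_flux (fun s t => complex.Re (g (s +i* t)%C))
              (fun s t => complex.Im (g (s +i* t)%C)) (- a) (- a) (a + a) = 0.
Proof.
move=> a0 cg dg.
have a2 : (a + a) / 2 = a by lra.
have sq b c : 0 <= b + a -> b <= 0 -> 0 <= c + a -> c <= 0 -> forall s t,
    in_square b c a s t -> centred_square a (s +i* t)%C.
  by move=> ? ? ? ? s t [? ?]; split; rewrite /= ler_norml; lra.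
have csq b c : 0 <= b + a -> b <= 0 -> 0 <= c + a -> c <= 0 ->
  continuous_on_square (fun s t => complex.Re (g (s +i* t)%C)) b c a /\
  continuous_on_square (fun s t => complex.Im (g (s +i* t)%C)) b c a.
  move=> ? ? ? ?; split=> s t st.
    by have [] := @plane_continuous_cmod g s t (cg _ (sq b c _ _ _ _ s t st)).
  by have [] := @plane_continuous_cmod g s t (cg _ (sq b c _ _ _ _ s t st)).
rewrite square_flux_subdivide; first last.
- move=> s t [? ?]; have [] := @plane_continuous_cmod g s t (cg _ _) => //.
  by split; rewrite /= ler_norml; lra.
- move=> s t [? ?]; have [] := @plane_continuous_cmod g s t (cg _ _) => //.
  by split; rewrite /= ler_norml; lra.
- lra.
rewrite a2; have -> : - a + a = 0 by lra.
have zero b c : 0 <= b + a -> b <= 0 -> 0 <= c + a -> c <= 0 ->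
    (0 <= c) || (c + a <= 0) ->
    square_flux (fun s t => complex.Re (g (s +i* t)%C))
              (fun s t => complex.Im (g (s +i* t)%C)) b c a = 0.
  move=> b1 b2 c1 c2 c0; apply: (goursat _ _ 0) => //.
  - by have [] := csq b c b1 b2 c1 c2.
  - by have [] := csq b c b1 b2 c1 c2.
  move=> s t st t0; apply: cauchy_riemann_differentiable.
  by apply: dg => //; exact: sq st.
rewrite !zero ?addr0//; lra.
Qed.

End complex_modulus.

(** * Divided differences and Cauchy's bound *)

Section divided_difference.
Context {R : realType}.
Notation C := (Cplx R).
Implicit Types (z w : C) (g : C -> C).

(** The value at w = z is the one that makes the quotient continuous there when g is differentiable
    at z. *)
Definition divided_difference g z w : C :=
  if w == z then 'D_1 g z else (g w - g z) / (w - z).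

Lemma divided_differenceE g z w :
  (w - z) * divided_difference g z w = g w - g z.
Proof.
rewrite /divided_difference; have [->|wz] := eqVneq w z.
  by rewrite !subrr mul0r.
by rewrite mulrC divfK// subr_eq0.
Qed.

Lemma cmod_divided_difference g z w : w != z ->
  cmod (divided_difference g z w) = cmod (g w - g z) / cmod (w - z).
Proof. by rewrite /divided_difference => /negPf->; rewrite cmodM cmodV. Qed.

Lemma near_divided_difference g z w : w != z ->
  \forall v \near w, (g v - g z) / (v - z) = divided_difference g z v.
Proof.
move=> wz; apply/nbhs_cmodP; exists (cmod (w - z)).
  by rewrite cmod_gt0 subr_eq0.
move=> v; rewrite /divided_difference; have [->|//] := eqVneq v z.
by rewrite -cmodN opprB ltxx.
Qed.

Lemma differentiable_divided_difference g z w : w != z ->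
  differentiable g w -> differentiable (divided_difference g z) w.
Proof.
move=> wz dg; apply/derivable1_diffP.
apply: near_eq_derivable (near_divided_difference g z w wz) _.
apply/derivable1_diffP.
have dn : differentiable (g \- cst (g z)) w.
  exact: differentiableB dg (differentiable_cst _ _).
have di : differentiable (@idfun C) w by apply/derivable1_diffP; exact: derivable_id.
have dd : differentiable (idfun \- cst z) w.
  exact: differentiableB di (differentiable_cst _ _).
have wz0 : (idfun \- cst z) w != 0 by rewrite subr_eq0.
exact: (differentiableM dn (differentiableV dd wz0)).
Qed.

Lemma continuous_divided_difference g z w : w != z ->
  {for w, continuous g} -> {for w, continuous (divided_difference g z)}.
Proof.
move=> wz cg; rewrite /prop_for /continuous_at.
rewrite -(nbhs_singleton (near_divided_difference g z w wz)).
apply: cvg_trans; first exact: (near_eq_cvg (near_divided_difference g z w wz)).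
have cn : (g \- cst (g z)) v @[v --> w] --> g w - g z.
  exact: (cvgB cg (cvg_cst _)).
have cd : (idfun \- cst z) v @[v --> w] --> w - z.
  exact: (cvgB cvg_id (cvg_cst _)).
have wz0 : w - z != 0 by rewrite subr_eq0.
exact: (cvgM cn (cvgV wz0 cd)).
Qed.

(** Continuity is all that one gets at the node; it suffices, since nodes are real and
    [goursat_centred] asks only for continuity on the real axis. *)
Lemma continuous_divided_difference_node g z :
  differentiable g z -> {for z, continuous (divided_difference g z)}.
Proof.
move=> /derivable1_diffP dg; apply/continuous_cmodP => e e0.
move/cvgrPdist_le : dg => /(_ (e%:C%C : C)).
rewrite ltcR => /(_ e0); rewrite near_withinE => /nbhs_cmodP[d d0 dP].
exists d => // v vw; have [->|vnw] := eqVneq v z; first by rewrite subrr cmod0 ltW.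
have := dP (v - z); rewrite subr0 subr_eq0 => /(_ vw vnw).
rewrite normC_cmod lecR /= scaler1 subrK -cmodN opprB.
rewrite /divided_difference eqxx (negPf vnw) mulrC.
by apply: le_trans; rewrite lexx.
Qed.

End divided_difference.

Section cauchy_bound.
Context {R : realType}.
Notation C := (Cplx R).

(** Lower bound for the kernel 1/(w - x) on the boundary: for |x| <= a/2, |w - x|^2 is at most
    ((3/2)^2 + 1) a^2 = 13/4 a^2. *)
Lemma inv_lower_bound (a p n : R) : 0 < a -> 0 < n -> n <= 13 / 4 * a ^+ 2 ->
  a / 2 <= p -> 2 / 13 / a <= p / n.
Proof.
move=> a0 n0 na ap; rewrite ler_pdivlMr//; apply: (le_trans _ ap).
have -> : a / 2 = 2 / 13 / a * (13 / 4 * a ^+ 2) by field; rewrite gt_eqF.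
by rewrite ler_pM2l// !divr_gt0.
Qed.

Lemma sqr_le_of_itv (u b : R) : - b <= u <= b -> u ^+ 2 <= b ^+ 2.
Proof. by move=> ub; rewrite -subr_ge0 subr_sqr mulr_ge0//; lra. Qed.

(* Cauchy's formula on the square, in the form g(x) I = (integral of
   g(w)/(w - x) dw), with only a lower bound for Im I where
   I = (integral of dw/(w - x)). *)
Lemma cauchy_bound (a M : R) (g : C -> C) (x : R) : 0 < a -> `|x| <= a / 2 ->
  (forall z, centred_square a z -> {for z, continuous g}) ->
  (forall z, centred_square a z -> complex.Im z != 0 -> differentiable g z) ->
  differentiable g (x%:C%C : C) ->
  (forall z, square_boundary a z -> cmod (g z) <= M) ->
  cmod (g x%:C%C) <= 10 * M.
Proof.
move=> a0 xa cg dg dgx gM; rewrite leNgt; apply/negP => bad.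
(* Multiplication by the conjugate of g x turns the term g x / (w - x) into m^2 / (w - x) with m^2
   real, so that imaginary parts of the kernel integral are enough. *)
pose z : C := x%:C%C; pose m := cmod (g z); pose k : C := conjc (g z).
pose q w : C := k * divided_difference g z w.
have M0 : 0 <= M.
  apply: le_trans (cmod_ge0 (g (a +i* a)%C)) (gM _ _).
  by split; [split|left]; rewrite /= gtr0_norm.
have m0 : 0 < m by rewrite /m; lra.
have zneq w : centred_square a w -> complex.Im w != 0 -> w != z.
  by move=> _; apply: contra => /eqP ->.
have cq w : centred_square a w -> {for w, continuous q}.
  move=> wa; suff cq : {for w, continuous (divided_difference g z)}.
    exact: (cvgM (cvg_cst k) cq).
  have [->|wz] := eqVneq w z; first exact: continuous_divided_difference_node.
  exact: continuous_divided_difference (cg _ wa).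
have dq w : centred_square a w -> complex.Im w != 0 -> differentiable q w.
  move=> wa w0; apply: (differentiableM (differentiable_cst k w)).
  by apply: differentiable_divided_difference (dg _ wa w0); exact: zneq.
(* The flux of q is zero by Goursat; the rest of the proof shows that it is negative. *)
have := @goursat_centred R a q a0 cq dq; apply/eqP; rewrite lt_eqF//.
have bd s t : square_boundary a (s +i* t)%C ->
    [/\ complex.Re (q (s +i* t)%C) <=
          2 * m * M / a - m ^+ 2 * ((s - x) / ((s - x) ^+ 2 + t ^+ 2)),
        - complex.Re (q (s +i* t)%C) <=
          2 * m * M / a + m ^+ 2 * ((s - x) / ((s - x) ^+ 2 + t ^+ 2)),
        complex.Im (q (s +i* t)%C) <=
          2 * m * M / a - m ^+ 2 * (- t / ((s - x) ^+ 2 + t ^+ 2)) &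
        - complex.Im (q (s +i* t)%C) <=
          2 * m * M / a + m ^+ 2 * (- t / ((s - x) ^+ 2 + t ^+ 2))].
  move=> bst; have far : a / 2 <= cmod ((s +i* t)%C - z).
    have [_ [sa|ta]] := bst; [rewrite /= in sa|rewrite /= in ta].
      have : `|s - x| <= cmod ((s +i* t)%C - z) := cmod_Re ((s +i* t)%C - z).
      by have := ler_normD (s - x) x; rewrite subrK sa; lra.
    have : `|t - 0| <= cmod ((s +i* t)%C - z) := cmod_Im ((s +i* t)%C - z).
    by rewrite subr0 ta; lra.
  have wz : (s +i* t)%C != z.
    by apply/eqP => e; move: far; rewrite e subrr cmod0; lra.
  have small : cmod (k * g (s +i* t)%C / ((s +i* t)%C - z)) <= 2 * m * M / a.
    rewrite !cmodM cmodV (_ : cmod k = m); last first.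
      by rewrite /k /m !cmodE; case: (g z) => ? ? /=; rewrite sqrrN.
    have -> : 2 * m * M / a = m * M * (a / 2)^-1 by rewrite invf_div; lra.
    have h1 : m * cmod (g (s +i* t)%C) <= m * M by rewrite ler_pM2l//; exact: gM.
    have h2 : (cmod ((s +i* t)%C - z))^-1 <= (a / 2)^-1.
      by rewrite lef_pV2// posrE; [apply: lt_le_trans far|]; lra.
    by apply: ler_pM h1 h2; rewrite ?invr_ge0 ?cmod_ge0// mulr_ge0 ?cmod_ge0// ltW.
  have qE : q (s +i* t)%C = k * g (s +i* t)%C / ((s +i* t)%C - z) -
      (m ^+ 2)%:C%C * ((s - x) +i* t)%C^-1.
    rewrite /q /divided_difference (negPf wz).
    have -> : (m ^+ 2)%:C%C = k * g z :> C.
      rewrite /m sqr_cmod /k; case: (g z) => u v /=.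
      by apply/eqP; rewrite eq_complex/=; apply/andP; split; apply/eqP; ring.
    have -> : ((s - x) +i* t)%C = (s +i* t)%C - z :> C.
      by apply/eqP; rewrite eq_complex/= subr0 !eqxx.
    by rewrite mulrBl mulrBr !mulrA.
  have := le_trans (cmod_Re _) small; have := le_trans (cmod_Im _) small.
  rewrite qE; set w := k * _ / _ => hI hR.
  have -> : complex.Re (w - (m ^+ 2)%:C%C * ((s - x) +i* t)%C^-1) =
    complex.Re w - m ^+ 2 * ((s - x) / ((s - x) ^+ 2 + t ^+ 2)).
    by case: w {hI hR} => ? ? /=; rewrite mul0r subr0.
  have -> : complex.Im (w - (m ^+ 2)%:C%C * ((s - x) +i* t)%C^-1) =
    complex.Im w - m ^+ 2 * (- t / ((s - x) ^+ 2 + t ^+ 2)).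
    by case: w {hI hR} => ? ? /=; rewrite mul0r addr0 mulNr.
  by move: hI hR; rewrite !ler_norml => /andP[? ?] /andP[? ?]; split; lra.
have sqb s : - a <= s <= - a + (a + a) ->
    [/\ square_boundary a (s +i* a)%C, square_boundary a (s +i* - a)%C,
     square_boundary a (a +i* s)%C & square_boundary a (- a +i* s)%C].
  move=> sa; have ? : `|s| <= a by rewrite ler_norml; lra.
  have ? : `|a| = a by rewrite gtr0_norm. 
  by split; split; try split; rewrite /= ?normrN; try lra; by [left|right].
have cqU := fun s t h => (@plane_continuous_cmod R q s t h).1.
have cqV := fun s t h => (@plane_continuous_cmod R q s t h).2.
have aaE : - a + (a + a) = a by lra.
have xb : - (a / 2) <= x <= a / 2 by rewrite -ler_norml.
have hV : segment_integral (- a) (- a + (a + a)) (fun s => complex.Im (q (s +i* - a)%C)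
    - complex.Im (q (s +i* (- a + (a + a)))%C)) <=
    (4 * m * M / a - m ^+ 2 * (8 / 13 / a)) * (- a + (a + a) - - a).
  apply: segment_integral_le; first lra.
    move=> s /sqb[[b1 _] [b2 _] _ _]; rewrite aaE.
    apply: continuousB.
      exact: (@plane_continuous_slicex _ (fun s t => complex.Im (q (s +i* t)%C)) s (- a) (cqV _ _ (cq _ b2))).
    exact: (@plane_continuous_slicex _ (fun s t => complex.Im (q (s +i* t)%C)) s a (cqV _ _ (cq _ b1))).
  move=> s sa; have [/bd[_ _ _ h1] /bd[_ _ h2 _] _ _] := sqb _ sa.
  rewrite aaE.
  (* On horizontal sides the imaginary part of w - x has modulus a, while on vertical sides the real
     part is only known to exceed a/2; the kernel bound is twice as good here. *)
  have : 4 / 13 / a <= a / ((s - x) ^+ 2 + a ^+ 2).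
    have -> : 4 / 13 / a = 2 * (2 / 13 / a) by lra.
    have := @inv_lower_bound a (a / 2) ((s - x) ^+ 2 + a ^+ 2) a0.
    have -> : a / 2 / ((s - x) ^+ 2 + a ^+ 2) = a / ((s - x) ^+ 2 + a ^+ 2) / 2 by lra.
    have sx : (s - x) ^+ 2 <= (3 / 2 * a) ^+ 2 by apply: sqr_le_of_itv; lra.
    have := sqr_ge0 (s - x); have a20 : 0 < a ^+ 2 by rewrite exprn_gt0.
    move=> sx0 /(_ _ _ (lexx _)) h; have := h ltac:(lra) ltac:(rewrite exprMn in sx; lra).
    by lra.
  move: h1 h2; rewrite opprK sqrrN mulNr; set u := a / _ => h1 h2 uge.
  have : m ^+ 2 * (4 / 13 / a) <= m ^+ 2 * u by rewrite ler_wpM2l// sqr_ge0.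
  lra.
have hU : segment_integral (- a) (- a + (a + a)) (fun t =>
    complex.Re (q ((- a + (a + a)) +i* t)%C)
    - complex.Re (q (- a +i* t)%C)) <=
    (4 * m * M / a - m ^+ 2 * (4 / 13 / a)) * (- a + (a + a) - - a).
  apply: segment_integral_le; first lra.
    move=> s /sqb[_ _ [b1 _] [b2 _]]; rewrite aaE.
    apply: continuousB.
      exact: (@plane_continuous_slicey _ (fun s t => complex.Re (q (s +i* t)%C)) a s (cqU _ _ (cq _ b1))).
    exact: (@plane_continuous_slicey _ (fun s t => complex.Re (q (s +i* t)%C)) (- a) s (cqU _ _ (cq _ b2))).
  move=> s sa; have [_ _ /bd[h1 _ _ _] /bd[_ h2 _ _]] := sqb _ sa.
  rewrite aaE.
  have ax1 : (a - x) ^+ 2 <= (3 / 2 * a) ^+ 2 by apply: sqr_le_of_itv; lra.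
  have ax2 : (- a - x) ^+ 2 <= (3 / 2 * a) ^+ 2 by apply: sqr_le_of_itv; lra.
  have s2 : s ^+ 2 <= a ^+ 2 by apply: sqr_le_of_itv; lra.
  have s20 := sqr_ge0 s; rewrite exprMn in ax1; rewrite exprMn in ax2.
  have u1 : 2 / 13 / a <= (a - x) / ((a - x) ^+ 2 + s ^+ 2).
    have : 0 < (a - x) ^+ 2 by rewrite exprn_gt0//; lra.
    by move=> ?; apply: inv_lower_bound => //; lra.
  have u2 : 2 / 13 / a <= (a + x) / ((- a - x) ^+ 2 + s ^+ 2).
    have : 0 < (- a - x) ^+ 2.
      by rewrite (_ : - a - x = - (a + x)) ?sqrrN ?exprn_gt0//; lra.
    by move=> ?; apply: inv_lower_bound => //; lra.
  have : m ^+ 2 * (2 / 13 / a) <= m ^+ 2 * ((a - x) / ((a - x) ^+ 2 + s ^+ 2)).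
    by rewrite ler_wpM2l// sqr_ge0.
  have : m ^+ 2 * (2 / 13 / a) <= m ^+ 2 * ((a + x) / ((- a - x) ^+ 2 + s ^+ 2)).
    by rewrite ler_wpM2l// sqr_ge0.
  move: h1 h2; have -> : - a - x = - (a + x) by lra.
  rewrite mulNr; lra.
apply: le_lt_trans (lerD hV hU) _.
have -> : - a + (a + a) - - a = 2 * a by lra.
rewrite -mulrDl pmulr_llt0; last lra.
(* The kernel contributes 8/13 + 4/13 = 12/13, and m > 10 M makes 8 M - 12/13 m negative. *)
have -> : 4 * m * M / a - m ^+ 2 * (8 / 13 / a) + (4 * m * M / a - m ^+ 2 * (4 / 13 / a))
  = (8 * M - 12 / 13 * m) * (m / a) by rewrite expr2; lra.
rewrite pmulr_llt0 ?divr_gt0//; rewrite /m; lra.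
Qed.

End cauchy_bound.

(** * Newton interpolation *)

Section newton.
Context {R : realType}.
Notation C := (Cplx R).
Variables (a : R) (t : nat -> R).
Hypotheses (a0 : 0 < a) (ta : forall i, `|t i| <= a / 2) (tI : injective t).
Implicit Types (g : C -> C) (w : C).

(** The classical g[t_0, ..., t_(k-1), w] as a function of its last argument. *)
Fixpoint newton_quotient g k : C -> C :=
  if k is k'.+1 then divided_difference (newton_quotient g k') (t k')%:C%C else g.

Definition newton_basis k w := \prod_(i < k) (w - (t i)%:C%C).

Lemma newton_expansion g n w : g w =
  \sum_(i < n) newton_quotient g i (t i)%:C%C * newton_basis i w +
  newton_quotient g n w * newton_basis n w.
Proof.
elim: n => [|n IH]; first by rewrite big_ord0 add0r /newton_basis big_ord0 mulr1.
rewrite big_ord_recr/= -addrA {1}IH; congr (_ + _).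
have e := divided_differenceE (newton_quotient g n) (t n)%:C%C w.
rewrite [newton_basis n.+1 w]big_ord_recr/= -/(newton_basis n w).
by rewrite mulrCA [_ * (w - _)]mulrC e mulrBr addrC [RHS]addrC; ring.
Qed.

Lemma node_in_square i : centred_square a (t i)%:C%C.
Proof. have ? := a0; split; rewrite /= ?normr0 ?(ltW a0)//; apply: le_trans (ta i) _; lra. Qed.

Lemma node_neq i k : (i < k)%N -> ((t k)%:C%C : C) != (t i)%:C%C.
Proof. by move=> ik; apply/eqP => -[] /tI ki; rewrite ki ltnn in ik. Qed.

(** The node t k differs from the earlier ones, so the k-th quotient is differentiable there and the
    next one continuous. Differentiability is lost only at the nodes already used. *)
Lemma newton_quotient_regular g : 
  (forall w, centred_square a w -> differentiable g w) -> forall k w,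
  centred_square a w -> {for w, continuous (newton_quotient g k)} /\
  ((forall i, (i < k)%N -> w != (t i)%:C%C) -> differentiable (newton_quotient g k) w).
Proof.
move=> dg; elim=> [|k IH] w wa /=.
  by split => [|_]; [apply: differentiable_continuous|]; exact: dg.
split=> [|wt].
  have [->|wtk] := eqVneq w (t k)%:C%C.
    apply: continuous_divided_difference_node.
    by apply: (IH _ (node_in_square k)).2 => i; exact: node_neq.
  exact: continuous_divided_difference wtk (IH _ wa).1.
apply: differentiable_divided_difference; first exact: wt.
by apply: (IH _ wa).2 => i ik; apply: wt; rewrite ltnS ltnW.
Qed.

Lemma newton_quotient_at g (M : R) k (x : R) :
  (forall w, centred_square a w -> differentiable g w) ->
  (forall i, (i < k)%N -> x != t i) -> `|x| <= a / 2 ->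
  (forall w, square_boundary a w -> cmod (newton_quotient g k w) <= M) ->
  cmod (newton_quotient g k x%:C%C) <= 10 * M.
Proof.
move=> dg xt xa gM; have ? := a0; apply: (cauchy_bound a M _ x) => //.
- by move=> z /(newton_quotient_regular g dg k)[].
- move=> z /(newton_quotient_regular g dg k)[_ H] z0; apply: H => i _.
  by apply: contra z0 => /eqP ->.
- apply: (newton_quotient_regular g dg k _ _).2.
    by split; rewrite /= ?normr0 ?(ltW a0)//; apply: le_trans xa _; lra.
  by move=> i /xt; apply: contra => /eqP[] ->.
Qed.

(** On the boundary |w - t k| >= a/2, and by [cauchy_bound] the value at the node is at most 10
    times the boundary bound. Each step thus costs (1 + 10) / (a/2) = 22/a. *)
Lemma newton_quotient_bound g (M : R) :
  (forall w, centred_square a w -> differentiable g w) ->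
  (forall w, centred_square a w -> cmod (g w) <= M) -> forall k w,
  square_boundary a w -> cmod (newton_quotient g k w) <= M * (22 / a) ^+ k.
Proof.
move=> dg gM; have ? := a0; elim=> [|k IH] w wa; first by rewrite expr0 mulr1; apply: gM; case: wa.
have far : a / 2 <= cmod (w - (t k)%:C%C).
  have tak := ta k; case: w wa => x y [_ [xa|ya]]; [rewrite /= in xa|rewrite /= in ya].
    have : `|x - t k| <= cmod ((x +i* y)%C - (t k)%:C%C) :=
      cmod_Re ((x +i* y)%C - (t k)%:C%C).
    by have := ler_normD (x - t k) (t k); rewrite subrK xa; lra.
  have : `|y - 0| <= cmod ((x +i* y)%C - (t k)%:C%C) :=
    cmod_Im ((x +i* y)%C - (t k)%:C%C).
  by rewrite subr0 ya; lra.
have wt : w != (t k)%:C%C by rewrite -subr_eq0 -cmod_gt0; lra.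
rewrite /= cmod_divided_difference//.
rewrite ler_pdivrMr; last by lra.
have h1 := IH _ wa; have h2 : cmod (newton_quotient g k (t k)%:C%C) <= 10 * (M * (22 / a) ^+ k).
  by apply: newton_quotient_at => // i ik; rewrite (inj_eq tI) gtn_eqF.
have h3 := cmodB (newton_quotient g k w) (newton_quotient g k (t k)%:C%C).
apply: (le_trans h3); apply: (le_trans (lerD h1 h2)).
have m0 : 0 <= M * (22 / a) ^+ k by apply: le_trans h1; exact: cmod_ge0.
rewrite exprSr [M * (_ * _)]mulrA -[leRHS]mulrA.
have -> : M * (22 / a) ^+ k + 10 * (M * (22 / a) ^+ k) = M * (22 / a) ^+ k * 11 by lra.
apply: ler_wpM2l => //.
have {1}-> : 11 = 22 / a * (a / 2) by field; rewrite gt_eqF.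
by rewrite ler_wpM2l// divr_ge0// ltW.
Qed.

Lemma newton_quotient_node_bound g (M : R) :
  (forall w, centred_square a w -> differentiable g w) ->
  (forall w, centred_square a w -> cmod (g w) <= M) -> forall k,
  cmod (newton_quotient g k (t k)%:C%C) <= 10 * M * (22 / a) ^+ k.
Proof.
move=> dg gM k; rewrite -mulrA; apply: newton_quotient_at => //.
  by move=> i ik; rewrite (inj_eq tI) gtn_eqF.
exact: newton_quotient_bound.
Qed.

(** [newton_quotient_at] needs x distinct from the nodes; at a node the product of distances
    vanishes, so nothing has to be bounded. *)
Lemma newton_remainder g (M : R) n (x : R) :
  (forall w, centred_square a w -> differentiable g w) ->
  (forall w, centred_square a w -> cmod (g w) <= M) -> `|x| <= a / 2 ->
  cmod (newton_quotient g n x%:C%C * newton_basis n x%:C%C) <=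
  10 * M * (22 / a) ^+ n * \prod_(i < n) `|x - t i|.
Proof.
move=> dg gM xa.
have -> : cmod (newton_quotient g n x%:C%C * newton_basis n x%:C%C) =
    cmod (newton_quotient g n x%:C%C) * \prod_(i < n) `|x - t i|.
  rewrite cmodM /newton_basis; congr (_ * _).
  rewrite (big_morph cmod cmodM (id1 := 1)); last by rewrite (cmod_real 1) normr1.
  by apply: eq_bigr => i _; rewrite -rmorphB cmod_real.
have [/existsP[i /eqP xi]|/existsPn xt] := boolP [exists i : 'I_n, x == t i].
  by rewrite (bigD1 i)//= xi subrr normr0 mul0r !mulr0.
apply: ler_wpM2r; first by rewrite prodr_ge0.
rewrite -mulrA; apply: newton_quotient_at => //.
  by move=> i ik; exact: xt (Ordinal ik).
exact: newton_quotient_bound.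
Qed.

(* Away from earlier nodes the Newton quotient is a finite linear combination of
   values of H v, so it inherits holomorphy in the parameter v. *)
Lemma differentiable_newton_quotient_param (H : C -> C -> C) (v : C) :
  (forall w, centred_square a w -> differentiable (H ^~ w) v) -> forall k w,
  centred_square a w -> (forall i, (i < k)%N -> w != (t i)%:C%C) ->
  differentiable (fun v => newton_quotient (H v) k w) v.
Proof.
move=> dH; elim=> [|k IH] w wa wt /=; first exact: dH.
have wtk : w != (t k)%:C%C by exact: wt.
under eq_fun do rewrite /divided_difference (negPf wtk).
have d1 : differentiable (fun v => newton_quotient (H v) k w) v.
  by apply: IH => // i ik; apply: wt; rewrite ltnS ltnW.
have d2 : differentiable (fun v => newton_quotient (H v) k (t k)%:C%C) v.
  by apply: IH => [|i]; [exact: node_in_square|exact: node_neq].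
exact: (differentiableM (differentiableB d1 d2)
  (differentiable_cst ((w - (t k)%:C%C)^-1 : C) v)).
Qed.

End newton.

(** * Tensorised interpolation *)

Section tensor.
Context {R : realType}.
Notation C := (Cplx R).
Variable a : R.
Implicit Types (G : (nat -> C) -> C) (Z : nat -> C).

Definition update Z j w : nat -> C := fun i => if i == j then w else Z i.

Definition in_polysquare d Z := forall i, (i < d)%N -> centred_square a (Z i).

(* A point of C^d is a sequence of which only the first d terms matter, so that
   the induction on d needs no change of type. *)
Definition separately_holomorphic d G := forall Z, in_polysquare d Z ->
  forall j, (j < d)%N -> differentiable (fun w => G (update Z j w)) (Z j).

(** Distinct points of ]0, a/88]. Points of [- a/88, a/88] are within a/44 of them, and 22/a * a/44
    = 1/2 is the ratio of the geometric decay. *)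
Definition node i : R := a / 88 / i.+1%:R.

Definition splice d (x : nat -> R) Z : nat -> C :=
  fun i => if (i < d)%N then (x i)%:C%C else Z i.

(** A pair holds a coordinate and a node. The division by a/44 brings the factors into [-1, 1], the
    range in which the networks multiply. *)
Definition newton_factor (x : nat -> R) (q : nat * R) : R :=
  (x q.1 - q.2) / (a / 44).

Definition newton_monomial x (l : seq (nat * R)) : R :=
  \prod_(q <- l) newton_factor x q.

Lemma node_bounds i : 0 < a -> 0 < node i <= a / 88.
Proof.
move=> a0; rewrite divr_gt0 ?ltr0n ?divr_gt0//=.
by rewrite ler_pdivrMr ?ltr0n// ler_peMr ?ler1n// ltW// divr_gt0.
Qed.

Lemma node_inj : 0 < a -> injective node.
Proof.
move=> a0 i j; rewrite /node => /mulfI; rewrite gt_eqF ?divr_gt0// => /(_ isT).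
by move=> /invr_inj/eqP; rewrite eqr_nat eqSS => /eqP.
Qed.

Lemma node_half i : 0 < a -> `|node i| <= a / 2.
Proof.
by move=> a0; have := @node_bounds i a0; rewrite ler_norml => /andP[? ?]; lra.
Qed.

Lemma update_update Z j w v : update (update Z j w) j v = update Z j v.
Proof. by apply/funext => i; rewrite /update; case: eqP. Qed.

Lemma update_eq Z j w : update Z j w j = w.
Proof. by rewrite /update eqxx. Qed.

Lemma update_neq Z j w i : i != j -> update Z j w i = Z i.
Proof. by rewrite /update => /negPf->. Qed.

Lemma updateC Z i j w v : i != j ->
  update (update Z i w) j v = update (update Z j v) i w.
Proof.
move=> ij; apply/funext => k; rewrite /update.
by have [->|//] := eqVneq k j; rewrite eq_sym (negPf ij).
Qed.

Lemma update_same Z j : update Z j (Z j) = Z.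
Proof. by apply/funext => i; rewrite /update; case: eqP => [->|]. Qed.

Lemma in_polysquare_update d Z w : in_polysquare d Z -> centred_square a w ->
  in_polysquare d.+1 (update Z d w).
Proof.
move=> ZS wS i; rewrite ltnS leq_eqVlt /update => /orP[->//|id].
by rewrite ltn_eqF//; exact: ZS.
Qed.

(** Expansion in the variable of index d leaves a function of the preceding ones; the power of a/44
    undoes the normalisation of [newton_factor]. *)
Definition newton_coefficient d G k Z : C :=
  newton_quotient node (fun w => G (update Z d w)) k (node k)%:C%C *
  ((a / 44) ^+ k)%:C%C.

Lemma slice_holomorphic d G : separately_holomorphic d.+1 G ->
  forall Z, in_polysquare d Z ->
  forall w, centred_square a w -> differentiable (fun w => G (update Z d w)) w.
Proof.
move=> hG Z ZS w wS; have := hG _ (in_polysquare_update d Z w ZS wS) d (ltnSn d).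
rewrite update_eq (_ : (fun w' => _) = fun w => G (update Z d w))//.
by apply/funext => v; rewrite update_update.
Qed.

Lemma newton_coefficient_holomorphic d G k : 0 < a ->
  separately_holomorphic d.+1 G ->
  separately_holomorphic d (newton_coefficient d G k).
Proof.
move=> a0 hG Z ZS j jd; rewrite /newton_coefficient.
apply: (differentiableM _ (differentiable_cst (((a / 44) ^+ k)%:C%C : C) _)).
have ta i := @node_half i a0; have tI := node_inj a0.
pose H v w := G (update (update Z j v) d w).
apply: (@differentiable_newton_quotient_param R a node a0 ta tI H).
- move=> w wS; rewrite /H.
  have := hG _ (in_polysquare_update d Z w ZS wS) j (ltnW jd).
  rewrite update_neq ?ltn_eqF// (_ : (fun w' => _) = fun v => H v w)//.
  by apply/funext => v; rewrite /H updateC// gtn_eqF.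
- by apply: (@node_in_square R a node).
- by move=> i; apply: (@node_neq R node).
Qed.

Lemma newton_coefficient_bound d G M k Z : 0 < a ->
  separately_holomorphic d.+1 G ->
  (forall Z, in_polysquare d.+1 Z -> cmod (G Z) <= M) -> in_polysquare d Z ->
  cmod (newton_coefficient d G k Z) <= 10 * M * 2^-1 ^+ k.
Proof.
move=> a0 hG GM ZS; rewrite /newton_coefficient cmodM cmod_real.
have -> : (2^-1 : R) = 22 / a * (a / 44) by field; rewrite gt_eqF.
rewrite [X in _ <= _ * X]exprMn ger0_norm ?exprn_ge0 ?divr_ge0 ?(ltW a0)// mulrA.
apply: ler_wpM2r; first by rewrite exprn_ge0// divr_ge0// ltW.
apply: newton_quotient_node_bound => //.
- by move=> i; exact: node_half.
- exact: node_inj.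
- exact: slice_holomorphic.
- by move=> w wS; apply: GM; exact: in_polysquare_update.
Qed.

Definition node_prefix d k : seq (nat * R) := [seq (d, node i) | i <- index_iota 0 k].

Lemma node_prefix_monomial x d k : newton_monomial x (node_prefix d k) =
  \prod_(i < k) ((x d - node i) / (a / 44)).
Proof. by rewrite /newton_monomial big_map big_mkord. Qed.

Lemma node_prefix_monomial_le1 x d k : 0 < a -> `|x d| <= a / 88 ->
  `|newton_monomial x (node_prefix d k)| <= 1.
Proof.
move=> a0 xa; rewrite node_prefix_monomial normr_prod.
apply: prodr_ile1 => i _; rewrite normr_ge0/= normrM normfV.
rewrite [X in _ / X]gtr0_norm ?divr_gt0// ler_pdivrMr ?divr_gt0// mul1r.
move: xa; have := @node_bounds i a0; rewrite !ler_norml => /andP[? ?] /andP[? ?].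
by apply/andP; split; lra.
Qed.

Lemma newton_monomial_cat x l1 l2 :
  newton_monomial x (l1 ++ l2) = newton_monomial x l1 * newton_monomial x l2.
Proof. by rewrite /newton_monomial big_cat. Qed.

Lemma cmod_sum (I : Type) (r : seq I) (P : pred I) (F : I -> C) :
  cmod (\sum_(i <- r | P i) F i) <= \sum_(i <- r | P i) cmod (F i).
Proof.
elim/big_ind2: _ => [|u v w z uv wz|//]; first by rewrite cmod0.
by apply: (le_trans (cmodD _ _)); exact: lerD.
Qed.

Lemma sum_half_le2 n : \sum_(k < n) (2^-1 : R) ^+ k <= 2.
Proof.
suff -> : \sum_(k < n) (2^-1 : R) ^+ k = 2 - 2 * 2^-1 ^+ n.
  by rewrite gerBl mulr_ge0// exprn_ge0// invr_ge0.
elim: n => [|n IH]; first by rewrite big_ord0 expr0 mulr1 subrr.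
by rewrite big_ord_recr/= IH exprS; lra.
Qed.

Lemma splice_update d x Z :
  splice d.+1 x Z = update (splice d x Z) d (x d)%:C%C.
Proof.
apply/funext => i; rewrite /splice /update ltnS leq_eqVlt.
by have [->|//] := eqVneq i d.
Qed.

Lemma splice_in_polysquare d x Z : 0 < a ->
  (forall i, (i < d)%N -> `|x i| <= a / 88) -> in_polysquare d (splice d x Z).
Proof.
move=> a0 xa i id; rewrite /splice id; split; rewrite /= ?normr0 ?(ltW a0)//.
by apply: le_trans (xa _ id) _; lra.
Qed.

(** Induction on d: Newton expansion in the last variable, whose k-th coefficient is bounded by 10 M
    / 2^k and is expanded in turn. [Z0] fixes the coordinates from d on, on which G may depend. *)
Theorem newton_tensor_approximation d : 0 < a -> forall G M,
  separately_holomorphic d G ->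
  (forall Z, in_polysquare d Z -> cmod (G Z) <= M) -> forall n Z0,
  exists L : seq (C * seq (nat * R)),
  [/\ (size L <= n ^ d)%N,
    forall p, p \in L -> [/\ cmod p.1 <= 10 ^+ d * M, (size p.2 <= d * n)%N &
      forall q, q \in p.2 -> (q.1 < d)%N && (`|q.2| <= a / 88)] &
    forall x, (forall i, (i < d)%N -> `|x i| <= a / 88) ->
      cmod (G (splice d x Z0) -
            \sum_(p <- L) p.1 * (newton_monomial x p.2)%:C%C) <=
      30 ^+ d * M * 2^-1 ^+ n].
Proof.
move=> a0; elim: d => [|d IH] G M hG GM n Z0.
  exists [:: (G Z0, [::])]; split=> //.
    move=> p; rewrite inE => /eqP ->; split=> //=.
    by rewrite expr0 mul1r; exact: GM.
  move=> x _; rewrite big_seq1/= /newton_monomial big_nil mulr1.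
  rewrite (_ : splice 0 x Z0 = Z0); last exact/funext.
  rewrite subrr cmod0 expr0 mul1r mulr_ge0 ?exprn_ge0 ?invr_ge0//.
  by apply: (le_trans (cmod_ge0 (G Z0))); exact: GM.
have M0 : 0 <= M.
  apply: (le_trans (cmod_ge0 (G (fun=> 0)))); apply: GM => i _.
  by split; rewrite /= normr0 ltW.
have /choice[L HL] := fun k => IH (newton_coefficient d G k) (10 * M * 2^-1 ^+ k)
  (newton_coefficient_holomorphic d G k a0 hG)
  (fun Z => newton_coefficient_bound d G M k Z a0 hG GM) n Z0.
pose ext k (p : C * seq (nat * R)) := (p.1, node_prefix d k ++ p.2).
exists (flatten [seq [seq ext k p | p <- L k] | k <- index_iota 0 n]); split.
- rewrite size_flatten /shape -map_comp sumnE big_map.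
  apply: (@leq_trans (\sum_(0 <= k < n) n ^ d)%N); last first.
    by rewrite big_const_nat iter_addn_0 subn0 mulnC expnS.
  by apply: leq_sum => k _; rewrite /= size_map; have [] := HL k.
- move=> p /flattenP[_ /mapP[k + ->] /mapP[p' p'L ->]].
  rewrite mem_index_iota => /andP[_ kn]; have [_ /(_ p' p'L)[h1 h2 h3] _] := HL k.
  split=> /=.
  + apply: (le_trans h1).
    have -> : 10 ^+ d.+1 * M = 10 ^+ d * (10 * M) by rewrite exprS; ring.
    apply: ler_wpM2l; first by rewrite exprn_ge0.
    rewrite ler_piMr ?mulr_ge0// exprn_ile1 ?invr_ge0//.
    by rewrite invf_le1// ler1n.
  + rewrite size_cat size_map size_iota subn0 mulSn leq_add//; exact: ltnW.
  + move=> q; rewrite mem_cat => /orP[/mapP[i _ ->]/=|/h3/andP[qd ->]].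
      rewrite ltnSn/=; have /andP[n0 n1] := @node_bounds i a0.
      by rewrite gtr0_norm.
    by rewrite ltnS ltnW.
move=> x xa; have xda : `|x d| <= a / 88 by exact: xa.
have xa' i : (i < d)%N -> `|x i| <= a / 88 by move=> id; apply: xa; exact: ltnW.
rewrite splice_update; set Y := splice d x Z0.
have YS : in_polysquare d Y by exact: splice_in_polysquare.
pose g w := G (update Y d w).
have hg := slice_holomorphic d G hG Y YS.
have gM w : centred_square a w -> cmod (g w) <= M.
  by move=> wS; apply: GM; exact: in_polysquare_update.
rewrite -/(g (x d)%:C%C) (newton_expansion node g n).
pose S k := \sum_(p <- L k) p.1 * (newton_monomial x p.2)%:C%C.
pose mon k := newton_monomial x (node_prefix d k).
have -> : \sum_(p <- flatten [seq [seq ext k p | p <- L k] | k <- index_iota 0 n])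
    p.1 * (newton_monomial x p.2)%:C%C = \sum_(k < n) (mon k)%:C%C * S k.
  rewrite big_flatten big_map big_mkord; apply: eq_bigr => k _.
  rewrite big_map mulr_sumr; apply: eq_bigr => p _ /=.
  by rewrite newton_monomial_cat rmorphM/= mulrCA.
have termE k : newton_quotient node g k (node k)%:C%C * newton_basis node k (x d)%:C%C
    = (mon k)%:C%C * newton_coefficient d G k Y.
  rewrite /newton_coefficient -/g mulrCA; congr (_ * _); rewrite -rmorphM/=.
  rewrite /newton_basis /mon node_prefix_monomial big_split/= -mulrA.
  rewrite prodr_const card_ord -exprMn mulVf ?expr1n ?mulr1; last first.
    by rewrite gt_eqF// divr_gt0.
  by rewrite rmorph_prod; apply: eq_bigr => i _; rewrite rmorphB.
under eq_bigr do rewrite termE.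
rewrite addrAC -sumrB.
apply: (le_trans (cmodD _ _)).
(* 30 = 20 + 10: the errors of the coefficients sum to at most 2 * 10, since the powers of 1/2 sum
   to at most 2, and the Newton remainder adds 10. *)
have -> : 30 ^+ d.+1 * M * 2^-1 ^+ n =
    30 ^+ d * (10 * M) * 2^-1 ^+ n * 2 + 30 ^+ d * (10 * M) * 2^-1 ^+ n.
  by rewrite exprS; lra.
apply: lerD.
  apply: (le_trans (cmod_sum _ _ _ _)).
  apply: (@le_trans _ _ (30 ^+ d * (10 * M) * 2^-1 ^+ n * \sum_(k < n) 2^-1 ^+ k)).
    rewrite mulr_sumr; apply: ler_sum => k _.
    rewrite -mulrBr cmodM cmod_real; have [_ _ /(_ x xa') hk] := HL k.
    apply: (@le_trans _ _ (1 * (30 ^+ d * (10 * M * 2^-1 ^+ k) * 2^-1 ^+ n))).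
      apply: ler_pM; rewrite ?cmod_ge0//; exact: node_prefix_monomial_le1.
    by rewrite mul1r mulrA [leRHS]mulrAC.
  by rewrite ler_wpM2l ?sum_half_le2// !mulr_ge0 ?exprn_ge0 ?invr_ge0.
have xd2 : `|x d| <= a / 2 by apply: le_trans xda _; lra.
have := @newton_remainder R a node a0 (fun i => node_half i a0) (node_inj a0)
  g M n (x d) hg gM xd2.
move=> /le_trans; apply.
have -> : \prod_(i < n) `|x d - node i| =
    `|newton_monomial x (node_prefix d n)| * (a / 44) ^+ n.
  rewrite node_prefix_monomial normr_prod -[in X in _ * X](card_ord n) -prodr_const.
  rewrite -big_split/=; apply: eq_bigr => i _.
  by rewrite normrM normfV [X in _ / X]gtr0_norm ?divr_gt0// divfK// gt_eqF// divr_gt0.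
have := node_prefix_monomial_le1 x d n a0 xda; set u := `|_| => u1.
have -> : 10 * M * (22 / a) ^+ n * (u * (a / 44) ^+ n) = u * (10 * M) * 2^-1 ^+ n.
  have -> : (2^-1 : R) = 22 / a * (a / 44) by field; rewrite gt_eqF.
  rewrite [(_ * (a / 44)) ^+ n]exprMn.
  by move: ((22 / a) ^+ n) ((a / 44) ^+ n) => p q; ring.
rewrite ler_wpM2r ?exprn_ge0 ?invr_ge0// ler_wpM2r ?mulr_ge0//.
by apply: (le_trans u1); rewrite exprn_ege1// ler1n.
Qed.

End tensor.

(** * Polynomial approximation of f around a real point *)

Section local_approximation.
Context {R : realType} (d : nat).
Notation C := (Cplx R).
Variables (a : R) (tau : 'I_d -> R) (F : 'cV[C]_d -> C) (f : 'cV[R]_d -> R) (B : R).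

Definition shifted_point (q : 'I_d -> R) (Z : nat -> C) : 'cV[C]_d :=
  \col_j ((q j)%:C%C + Z j).

(** Indexed by natural numbers, as the interpolation is, with default value 0 from d on. *)
Definition displacement (q : 'I_d -> R) (x : 'cV[R]_d) (i : nat) : R :=
  if insub i is Some j then x j 0 - q j else 0.

Lemma displacementE q x (j : 'I_d) : displacement q x j = x j 0 - q j.
Proof. by rewrite /displacement valK. Qed.

Lemma shifted_point_polystrip q Z : (forall j, a < tau j) ->
  in_polysquare a d Z -> polystrip tau (shifted_point q Z).
Proof.
move=> atau ZS j; rewrite /strip/= mxE raddfD/= add0r.
by apply: le_lt_trans (atau j); have [] := ZS j (ltn_ord j).
Qed.

Lemma differentiable_shifted_point q Z (j : 'I_d) :
  differentiable (fun w : C => shifted_point q (update Z j w)) (Z j).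
Proof.
have -> : (fun w : C => shifted_point q (update Z j w)) =
    cst (shifted_point q (update Z j 0)) \+ (fun w : C => w *: delta_mx j 0).
  apply/funext => w; apply/matrixP => i k; rewrite !mxE (ord1 k) eqxx andbT.
  have [->|ij] := eqVneq i j; first by rewrite !update_eq addr0 mulr1.
  by rewrite !update_neq//= mulr0 addr0.
apply: differentiableD; first exact: differentiable_cst.
apply: differentiableZl; apply/derivable1_diffP; exact: derivable_id.
Qed.

(** Since a < tau j, the polysquare around the real point q stays in the polystrip, and real parts
    there are at most |q j| + a in modulus, whence M. Taking real parts of the coefficients is
    harmless because f and the monomials are real at real points. *)
Lemma local_approximation (q : 'I_d -> R) (n : nat) :
  0 < a -> (forall j, a < tau j) -> 0 <= B ->
  holomorphic_on (polystrip tau) F ->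
  (forall x : 'cV[R]_d, F (to_complex x) = (f x)%:C%C) ->
  (forall z : 'cV[C]_d, polystrip tau z ->
     cmod (F z) <= B * expR (\sum_(j < d) (re_part z j 0) ^+ 2 / 4)) ->
  let M := B * expR (\sum_(j < d) (`|q j| + a) ^+ 2 / 4) in
  exists L : seq (R * seq (nat * R)),
  [/\ (size L <= n ^ d)%N,
    forall p, p \in L -> [/\ `|p.1| <= 10 ^+ d * M, (size p.2 <= d * n)%N &
      forall s, s \in p.2 -> (s.1 < d)%N && (`|s.2| <= a / 88)] &
    forall x : 'cV[R]_d, (forall j, `|x j 0 - q j| <= a / 88) ->
      `|f x - \sum_(p <- L) p.1 * newton_monomial a (displacement q x) p.2| <=
      30 ^+ d * M * 2^-1 ^+ n].
Proof.
move=> a0 atau B0 hF Ff FB M; pose G Z := F (shifted_point q Z).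
have hG : separately_holomorphic a d G.
  move=> Z ZS j jd; have dq := differentiable_shifted_point q Z (Ordinal jd).
  apply: (differentiable_comp dq); apply: hF; rewrite update_same.
  exact: shifted_point_polystrip.
have GM Z : in_polysquare a d Z -> cmod (G Z) <= M.
  move=> ZS; apply: (le_trans (FB _ (shifted_point_polystrip q Z atau ZS))).
  rewrite ler_wpM2l// ler_expR; apply: ler_sum => j _.
  rewrite ler_wpM2r ?invr_ge0// !mxE raddfD/=.
  apply: sqr_le_of_itv; rewrite -ler_norml; apply: (le_trans (ler_normD _ _)).
  by rewrite lerD2l; have [] := ZS j (ltn_ord j).
have [L [sL LP Lx]] := newton_tensor_approximation a d a0 G M hG GM n (fun=> 0).
exists [seq (complex.Re p.1, p.2) | p <- L]; split; first by rewrite size_map.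
  move=> _ /mapP[p pL ->] /=; have [h1 h2 h3] := LP p pL; split=> //.
  exact: (le_trans (cmod_Re _)).
move=> x xq; have := Lx (displacement q x).
have -> : G (splice d (displacement q x) (fun=> 0)) = (f x)%:C%C.
  rewrite /G -Ff; congr F; apply/matrixP => j k.
  by rewrite !mxE /splice ltn_ord displacementE -rmorphD/= addrC subrK.
have xa i : (i < d)%N -> `|displacement q x i| <= a / 88.
  by move=> id; have := displacementE q x (Ordinal id) => /= ->; exact: xq.
move=> /(_ xa); apply: le_trans; apply: (le_trans _ (cmod_Re _)).
have reS : complex.Re (\sum_(p <- L) p.1 * (newton_monomial a (displacement q x) p.2)%:C%C)
    = \sum_(p <- L) complex.Re p.1 * newton_monomial a (displacement q x) p.2.
  rewrite raddf_sum; apply: eq_bigr => -[[u v] l] _ /=; by rewrite mulr0 subr0.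
by rewrite raddfB/= reS big_map.
Qed.

End local_approximation.

(** * Parallel networks *)

Section nonzero_entries.
Context {R : realType}.

Lemma nb_nonzeroE m n (A : 'M[R]_(m, n)) :
  nb_nonzero A = (\sum_i \sum_j (A i j != 0)%R)%N.
Proof.
rewrite /nb_nonzero -sum1_card pair_big/= [LHS]big_mkcond/=.
by apply: eq_bigr => -[i j] _; rewrite inE; case: (_ != _).
Qed.

Lemma nb_nonzero_le m n (A : 'M[R]_(m, n)) : (nb_nonzero A <= m * n)%N.
Proof. by rewrite /nb_nonzero (leq_trans (max_card _))// card_prod !card_ord. Qed.

Lemma nb_nonzero_row m n1 n2 (A : 'M[R]_(m, n1)) (B : 'M[R]_(m, n2)) :
  nb_nonzero (row_mx A B) = (nb_nonzero A + nb_nonzero B)%N.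
Proof.
rewrite !nb_nonzeroE -big_split/=; apply: eq_bigr => i _.
rewrite big_split_ord/=; congr (_ + _)%N; apply: eq_bigr => j _;
  by rewrite ?row_mxEl ?row_mxEr.
Qed.

Lemma nb_nonzero_col m1 m2 n (A : 'M[R]_(m1, n)) (B : 'M[R]_(m2, n)) :
  nb_nonzero (col_mx A B) = (nb_nonzero A + nb_nonzero B)%N.
Proof.
rewrite !nb_nonzeroE big_split_ord/=; congr (_ + _)%N; apply: eq_bigr => i _;
  by apply: eq_bigr => j _; rewrite ?col_mxEu ?col_mxEd.
Qed.

Lemma nb_nonzero0 m n : nb_nonzero (0 : 'M[R]_(m, n)) = 0%N.
Proof.
by rewrite nb_nonzeroE big1// => i _; rewrite big1// => j _; rewrite mxE eqxx.
Qed.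

Lemma nb_nonzero_block m1 m2 n1 n2 (A : 'M[R]_(m1, n1)) (B : 'M[R]_(m2, n2)) :
  nb_nonzero (block_mx A 0 0 B) = (nb_nonzero A + nb_nonzero B)%N.
Proof. by rewrite nb_nonzero_col !nb_nonzero_row !nb_nonzero0 addn0. Qed.

Lemma nb_nonzeroD m n (A B : 'M[R]_(m, n)) :
  (nb_nonzero (A + B) <= nb_nonzero A + nb_nonzero B)%N.
Proof.
rewrite !nb_nonzeroE -big_split/=; apply: leq_sum => i _.
rewrite -big_split/=; apply: leq_sum => j _; rewrite mxE.
by case: eqP => //; case: eqP => [->|//]; case: eqP => [->|//]; rewrite addr0.
Qed.

End nonzero_entries.

Section parallel.
Context {R : realType}.

Lemma relu_col m n (u : 'cV[R]_m) (v : 'cV[R]_n) :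
  relu (col_mx u v) = col_mx (relu u) (relu v).
Proof. exact: map_col_mx. Qed.

(** Block diagonal hidden layers keep the networks apart until the output layer adds them; hence the
    equal depths. *)
Lemma parallel_net m1 m2 (n1 : relu_net R 1 m1) (n2 : relu_net R 1 m2) :
  net_depth n1 = net_depth n2 ->
  exists net : relu_net R 1 (m1 + m2),
  [/\ net_depth net = net_depth n1, (net_size net <= net_size n1 + net_size n2)%N &
    forall x1 x2, realize net (col_mx x1 x2) = realize n1 x1 + realize n2 x2].
Proof.
elim: n1 m2 n2 => [k1 W1 b1|k1 l1 W1 b1 n1 IH] m2 [k2 W2 b2|k2 l2 W2 b2 n2]//=.
  move=> _; exists (Output (row_mx W1 W2) (b1 + b2)); split=> //=.
    by rewrite nb_nonzero_row; have := nb_nonzeroD _ _ b1 b2; lia.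
  by move=> x1 x2; rewrite /affine mul_row_col addrACA.
move=> [/IH[net [dn sn rn]]].
(* The width (l1 + l2.+1).+1 is convertible to l1.+1 + l2.+1, so the block matrix needs no cast. *)
exists (@Hidden R 1 (k1 + k2) (l1 + l2.+1) (block_mx W1 0 0 W2) (col_mx b1 b2) net).
split=> /=; first by rewrite dn.
  rewrite (nb_nonzero_block _ _ _ _ W1 W2) (nb_nonzero_col _ _ _ b1 b2).
  by apply: leq_trans (leq_add (leqnn _) sn) _; lia.
move=> x1 x2; rewrite -rn; congr realize; rewrite -relu_col; congr relu.
have e : block_mx W1 0 0 W2 *m col_mx x1 x2 + col_mx b1 b2 =
    col_mx (affine W1 b1 x1) (affine W2 b2 x2).
  by rewrite mul_block_col !mul0mx addr0 add0r add_col_mx.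
exact: e.
Qed.

Definition net_computes d L S (g : 'cV[R]_d -> R) :=
  exists net : relu_net R 1 d,
  [/\ net_depth net = L, (net_size net <= S)%N & forall x, realize net x 0 0 = g x].

Lemma net_depthS m L (net : relu_net R 1 m) : net_depth net = L.+1 ->
  exists k (W : 'M[R]_(k.+1, m)) b net', net = @Hidden R 1 m k W b net'.
Proof. by case: net => // m' k W b n _; exists k, W, b, n. Qed.

(** The shared input is duplicated by stacking the two first hidden layers, hence the positive
    depth; from there on [parallel_net] applies. *)
Lemma net_computesD d L S1 S2 (g1 g2 : 'cV[R]_d -> R) :
  net_computes d L.+1 S1 g1 -> net_computes d L.+1 S2 g2 ->
  net_computes d L.+1 (S1 + S2) (fun x => g1 x + g2 x).
Proof.
move=> [n1 [d1 s1 r1]] [n2 [d2 s2 r2]].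
have [k1 [W1 [b1 [n1' e1]]]] := net_depthS _ _ n1 d1.
have [k2 [W2 [b2 [n2' e2]]]] := net_depthS _ _ n2 d2.
subst n1 n2; rewrite /= in d1 s1 r1 d2 s2 r2.
case: d1 => d1; case: d2 => d2.
have [|net [dn sn rn]] := parallel_net _ _ n1' n2'; first by rewrite d1 d2.
exists (@Hidden R 1 d (k1 + k2.+1) (col_mx W1 W2) (col_mx b1 b2) net); split=> /=.
- by rewrite dn d1.
- rewrite (nb_nonzero_col _ _ _ W1 W2) (nb_nonzero_col _ _ _ b1 b2).
  by apply: leq_trans (leq_add (leqnn _) sn) _; lia.
move=> x; have e : col_mx W1 W2 *m x + col_mx b1 b2 =
    col_mx (affine W1 b1 x) (affine W2 b2 x) by rewrite mul_col_mx add_col_mx.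
have := congr1 (fun u : 'cV[R]_1 => u 0 0) (rn (relu (affine W1 b1 x)) (relu (affine W2 b2 x))).
by rewrite mxE r1 r2 => <-; rewrite -relu_col -e.
Qed.

Lemma net_computes_sum d L S (I : Type) (l : seq I) (g : I -> 'cV[R]_d -> R) :
  net_computes d L.+1 S (fun=> 0) ->
  (forall i, net_computes d L.+1 S (g i)) ->
  net_computes d L.+1 ((size l).+1 * S) (fun x => \sum_(i <- l) g i x).
Proof.
move=> h0 hg; elim: l => [|i l IH].
  rewrite mul1n; have [net [dn sn rn]] := h0; exists net; split=> // x.
  by rewrite big_nil.
have [net [dn sn rn]] := net_computesD _ _ _ _ _ _ (hg i) IH.
by exists net; split=> // x; rewrite big_cons.
Qed.

End parallel.

(** * Networks of constant width as register machines *)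

Section register_machine.
Context {R : realType}.
Variable d : nat.
Implicit Types (x : 'cV[R]_d) (y u : R).

Definition pos_part (t : R) := Num.max t 0.

Lemma pos_partB t : pos_part t - pos_part (- t) = t.
Proof. by rewrite /pos_part /Num.max; do 2 case: ifPn; rewrite ?subr0; lra. Qed.

Lemma pos_partD t : pos_part t + pos_part (- t) = `|t|.
Proof.
rewrite /pos_part /Num.max; case: ltgtP => [t0|t0|->].
- by rewrite ltr0_norm// ifF ?add0r//; apply/negbTE; rewrite -leNgt; lra.
- by rewrite gtr0_norm// ifT ?addr0//; lra.
- by rewrite oppr0 ltxx normr0 addr0.
Qed.

Definition vec n (s : seq R) : 'cV[R]_n := \col_i nth 0 s i.

Definition mat m n (rows : seq (seq R)) : 'M[R]_(m, n) :=
  \matrix_(i, j) nth 0 (nth [::] rows i) j.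

Lemma vec6_col s : vec 6 s = col_mx (vec 3 (take 3 s)) (vec 3 (drop 3 s)) :> 'cV[R]_(3 + 3).
Proof.
apply/colP => i; rewrite !mxE; case: splitP => j ij; rewrite mxE ij.
  by rewrite nth_take.
by rewrite nth_drop.
Qed.

(* The networks have no skip connections, so every layer also carries the
   positive and negative parts of the input. *)
Definition encode (r : 'cV[R]_6) x : 'cV[R]_(6 + (d + d)) :=
  col_mx r (col_mx (relu x) (relu (- x))).

Lemma relu_relu n (v : 'cV[R]_n) : relu (relu v) = relu v.
Proof. by apply/colP => i; rewrite !mxE; apply/max_idPl; rewrite le_max lexx orbT. Qed.

Lemma relu_sub n (v : 'cV[R]_n) : relu v - relu (- v) = v.
Proof. by apply/colP => i; rewrite !mxE; exact: pos_partB. Qed.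

(** One layer can apply any affine update to the registers and the input: x is read off as relu x -
    relu (- x), and the carried halves are nonnegative, hence fixed by relu. *)
Lemma encode_layer (P : 'M[R]_6) (Q : 'M[R]_(6, d)) (c r : 'cV[R]_6) x :
  relu (affine (block_mx P (row_mx Q (- Q)) 0 1%:M) (col_mx c 0) (encode r x)) =
  encode (relu (P *m r + Q *m x + c)) x.
Proof.
rewrite /affine /encode mul_block_col mul_row_col mul0mx add0r mul1mx.
by rewrite add_col_mx addr0 mulNmx -mulmxBr relu_sub !relu_col !relu_relu.
Qed.

Definition layer_cost : nat := (6 + (d + d)) * (6 + (d + d)).+1.

(** [I] is a type of abstract states, encoded in the registers by [st]; [val] is what the remaining
    layers output from a state. Networks grow from the output backwards, one layer at a time, by
    [machine_step]. *)
Definition machine_computes (I : Type) L S (st : I -> 'cV[R]_6)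
    (val : I -> 'cV[R]_d -> R) :=
  exists net : relu_net R 1 (6 + (d + d)),
  [/\ net_depth net = L, (net_size net <= S)%N &
    forall i x, realize net (encode (st i) x) 0 0 = val i x].

Lemma machine_step I I' L S (st : I -> 'cV[R]_6) (st' : I' -> 'cV[R]_6) val
    (phi : I -> 'cV[R]_d -> I') (P : 'M[R]_6) (Q : 'M[R]_(6, d)) (c : 'cV[R]_6) :
  machine_computes I' L S st' val ->
  (forall i x, relu (P *m st i + Q *m x + c) = st' (phi i x)) ->
  machine_computes I L.+1 (layer_cost + S) st (fun i x => val (phi i x) x).
Proof.
move=> [net [dn sn rn]] Pst.
pose W := block_mx P (row_mx Q (- Q)) 0 1%:M; pose b : 'cV[R]_(6 + (d + d)) := col_mx c 0.
exists (@Hidden R 1 (6 + (d + d)) (5 + (d + d)) W b net); split=> /=.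
- by rewrite dn.
- apply: leq_add sn; rewrite /layer_cost mulnS addnC.
  by apply: leq_add; [rewrite (leq_trans (nb_nonzero_le _ _ _))// muln1|exact: nb_nonzero_le].
- by move=> i x; rewrite -rn -Pst -encode_layer.
Qed.

Definition tent (t : R) := 2 * pos_part t - 4 * pos_part (t - 2^-1).

(** For a and b the registers hold the two relu values of which [tent] is a linear combination; the
    accumulator, which has a sign, is stored as its two parts. *)
Definition loop_state (p : R * R * R) : 'cV[R]_6 :=
  vec 6 [:: pos_part p.1.1; pos_part (p.1.1 - 2^-1);
    pos_part p.1.2; pos_part (p.1.2 - 2^-1); pos_part p.2; pos_part (- p.2)].

(** Two squarings run side by side, and the accumulator collects the difference of their
    corrections. *)
Definition tent_step w (p : R * R * R) :=
  (tent p.1.1, tent p.1.2, p.2 - w * (tent p.1.1 - tent p.1.2)).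

Lemma relu_vec n s : relu (vec n s) = vec n (map pos_part s).
Proof.
apply/colP => i; rewrite !mxE; have [h|h] := ltnP i (size s).
  by rewrite (nth_map 0).
by rewrite !nth_default ?size_map// /Num.max ltxx.
Qed.

Lemma machine_tent_step L S w val :
  machine_computes _ L S loop_state val ->
  machine_computes _ L.+1 (layer_cost + S) loop_state (fun p x => val (tent_step w p) x).
Proof.
move=> /(@machine_step _ _ _ _ loop_state _ _ (fun p _ => tent_step w p)).
move=> /(_ (mat 6 6 [:: [:: 2; -4]; [:: 2; -4]; [:: 0; 0; 2; -4]; [:: 0; 0; 2; -4];
    [:: - (2 * w); 4 * w; 2 * w; - (4 * w); 1; -1];
    [:: (2 * w); - (4 * w); - (2 * w); 4 * w; -1; 1]]) 0
  (vec 6 [:: 0; - 2^-1; 0; - 2^-1])); apply.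
move=> [[a b] y] x; rewrite mul0mx addr0 /tent_step/=.
rewrite (_ : _ + _ = vec 6 [:: tent a; tent a - 2^-1; tent b; tent b - 2^-1;
   y - w * (tent a - tent b); - (y - w * (tent a - tent b))]); first exact: relu_vec.
apply/colP => i; rewrite !mxE /loop_state/= !big_ord_recl big_ord0 !mxE /tent.
have := pos_partB y.
move: (pos_part _) (pos_part _) (pos_part _) (pos_part _) (pos_part y) (pos_part (- y)).
by move=> a0 a1 b0 b1 y0 y1 <-; case: i => [[|[|[|[|[|[|//]]]]]] hi] /=; ring.
Qed.

Definition tent_loop (ws : seq R) p := foldl (fun p w => tent_step w p) p ws.

Lemma machine_tent_loop L S ws val :
  machine_computes _ L S loop_state val ->
  machine_computes _ (size ws + L) (size ws * layer_cost + S) loop_state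
    (fun p x => val (tent_loop ws p) x).
Proof.
move=> h; elim: ws => [//|w ws IH]; rewrite mulSn -addnA.
exact: machine_tent_step IH.
Qed.

(** Polarisation: y u is the difference of the squares of a = |y + u|/2 and b = |y - u|/2. The
    accumulator starts at a - b, as the expansion of t^2 starts at t. *)
Definition product_net ws y u := (tent_loop ws
  (`|y + u| / 2, `|y - u| / 2, `|y + u| / 2 - `|y - u| / 2)).2.

(** A factor computed by one hidden layer; width 3 because a hat function has three kinks. *)
Record ridge := Ridge {
  ridge_in : 'M[R]_(3, d); ridge_bias : 'cV[R]_3;
  ridge_out : 'rV[R]_3; ridge_shift : R }.

Definition ridge_eval (q : ridge) x : R :=
  (ridge_out q *m relu (affine (ridge_in q) (ridge_bias q) x)) 0 0 + ridge_shift q.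

(** The lower half of the registers is left as in [loop_state], which makes the transition a block
    matrix; the upper half receives the hidden units of a factor. *)
Definition read_state (p : 'cV[R]_3 * R * R) : 'cV[R]_6 :=
  col_mx p.1.1 (vec 3 [:: p.1.2; pos_part p.2; pos_part (- p.2)]) : 'cV[R]_(3 + 3).

Definition abs_state (p : R * R) : 'cV[R]_6 :=
  vec 6 [:: pos_part p.1; pos_part (- p.1); pos_part p.2; pos_part (- p.2)].

Lemma machine_read L S (q : ridge) val :
  machine_computes _ L S read_state val ->
  machine_computes _ L.+1 (layer_cost + S) loop_state (fun p x =>
    val (relu (affine (ridge_in q) (ridge_bias q) x), pos_part (p.1.2 - 2^-1), p.2) x).
Proof.
move=> /(@machine_step _ _ _ _ loop_state _ _ (fun p x =>
  (relu (affine (ridge_in q) (ridge_bias q) x), pos_part (p.1.2 - 2^-1), p.2))).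
move=> /(_ (block_mx 0 0 0 1%:M : 'M[R]_(3 + 3, 3 + 3)) (col_mx (ridge_in q) 0 : 'M[R]_(3 + 3, d))
  (col_mx (ridge_bias q) 0 : 'cV[R]_(3 + 3))); apply => p x.
have e (u v : 'cV[R]_3) : relu ((block_mx 0 0 0 1%:M : 'M[R]_(3 + 3, 3 + 3)) *m col_mx u v +
    col_mx (ridge_in q) 0 *m x + col_mx (ridge_bias q) 0) =
    col_mx (relu (affine (ridge_in q) (ridge_bias q) x)) (relu v).
  rewrite mul_block_col mul_col_mx !mul0mx mul1mx !add_col_mx !add0r !addr0.
  exact: relu_col.
rewrite /loop_state vec6_col; apply: (etrans (e _ _)).
rewrite relu_vec /read_state; congr col_mx.
congr (vec _ [:: _; _; _]);
  by rewrite /= /pos_part; apply/max_idPl; rewrite le_max lexx orbT.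
Qed.

Lemma machine_factor L S (q : ridge) val :
  machine_computes _ L S abs_state val ->
  machine_computes _ L.+1 (layer_cost + S) read_state (fun p x =>
    val (p.2 + ((ridge_out q *m p.1.1) 0 0 + ridge_shift q),
         p.2 - ((ridge_out q *m p.1.1) 0 0 + ridge_shift q)) x).
Proof.
move=> /(@machine_step _ _ _ _ read_state _ _ (fun p x =>
  (p.2 + ((ridge_out q *m p.1.1) 0 0 + ridge_shift q),
         p.2 - ((ridge_out q *m p.1.1) 0 0 + ridge_shift q)))).
pose s := vec 6 [:: 1; -1; -1; 1].
move=> /(_ (row_mx (s *m ridge_out q)
   (mat 6 3 [:: [:: 0; 1; -1]; [:: 0; -1; 1]; [:: 0; 1; -1]; [:: 0; -1; 1]]) : 'M[R]_(6, 3 + 3))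
  0 (ridge_shift q *: s)); apply => -[[v t] y] x.
rewrite mul0mx addr0 /read_state/=.
set B := mat 6 3 _; set k := (ridge_out q *m v).
have e (l : 'cV[R]_3) : relu (row_mx (s *m ridge_out q) B *m col_mx v l
    + ridge_shift q *: s) = relu (s *m k + B *m l + ridge_shift q *: s).
  by rewrite mul_row_col mulmxA.
apply: (etrans (e _)); clear e; clearbody k; rewrite (_ : _ + _ = vec 6 [:: y + (k 0 0 + ridge_shift q);
   - (y + (k 0 0 + ridge_shift q)); y - (k 0 0 + ridge_shift q);
   - (y - (k 0 0 + ridge_shift q))]).
  by rewrite relu_vec/=.
apply/colP => i; rewrite !mxE big_ord1 !big_ord_recl big_ord0 !mxE /=.
rewrite -[in RHS](pos_partB y); move: (k 0 0) (pos_part _) (pos_part _) (ridge_shift q).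
by move=> k0 y0 y1 sh; case: i => [[|[|[|[|[|[|//]]]]]] hi] /=; ring.
Qed.

Lemma machine_abs L S val :
  machine_computes _ L S loop_state val ->
  machine_computes _ L.+1 (layer_cost + S) abs_state (fun p x =>
    val (`|p.1| / 2, `|p.2| / 2, `|p.1| / 2 - `|p.2| / 2) x).
Proof.
move=> /(@machine_step _ _ _ _ abs_state _ _ (fun p x =>
  (`|p.1| / 2, `|p.2| / 2, `|p.1| / 2 - `|p.2| / 2))).
pose h : R := 2^-1.
move=> /(_ (mat 6 6 [:: [:: h; h]; [:: h; h]; [:: 0; 0; h; h]; [:: 0; 0; h; h];
    [:: h; h; - h; - h]; [:: - h; - h; h; h]]) 0 (vec 6 [:: 0; - h; 0; - h])); apply.
move=> [y u] x; rewrite mul0mx addr0 /=.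
rewrite (_ : _ + _ = vec 6 [:: `|y| / 2; `|y| / 2 - h; `|u| / 2; `|u| / 2 - h;
   `|y| / 2 - `|u| / 2; - (`|y| / 2 - `|u| / 2)]); first exact: relu_vec.
apply/colP => i; rewrite !mxE /abs_state/= !big_ord_recl big_ord0 !mxE -!pos_partD.
move: (pos_part _) (pos_part _) (pos_part _) (pos_part _) => y0 y1 u0 u1.
by rewrite /h; case: i => [[|[|[|[|[|[|//]]]]]] hi] /=; ring.
Qed.

(** Three layers precede the loop: the hidden units of the factor u, the signed sums y + u and y -
    u, and their absolute values. They are attached in reverse order. *)
Lemma machine_product L S ws (q : ridge) (H : R -> 'cV[R]_d -> R) :
  machine_computes _ L S loop_state (fun p x => H p.2 x) ->
  machine_computes _ (size ws + 3 + L) ((size ws + 3) * layer_cost + S) loop_state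
    (fun p x => H (product_net ws p.2 (ridge_eval q x)) x).
Proof.
move=> /(machine_tent_loop _ _ ws)/machine_abs/(machine_factor _ _ q)/(machine_read _ _ q).
move=> [net [dn sn rn]]; exists net; split=> //; first by rewrite dn; lia.
by apply: (leq_trans sn); rewrite mulnDl; lia.
Qed.

Definition chain ws (qs : seq ridge) y x :=
  foldl (fun y q => product_net ws y (ridge_eval q x)) y qs.

Lemma machine_chain ws qs (c : R) :
  machine_computes _ (size qs * (size ws + 3))
    (size qs * (size ws + 3) * layer_cost + layer_cost)
    loop_state (fun p x => c * chain ws qs p.2 x).
Proof.
elim: qs => [|q qs IH].
  exists (Output (row_mx (vec 6 [:: 0; 0; 0; 0; c; - c])^T 0) 0); split=> //=.
    apply: (leq_trans (leq_add (nb_nonzero_le _ _ _) (nb_nonzero_le _ _ _))).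
    by rewrite /layer_cost; nia.
  move=> [[a b] y] x; rewrite /affine /encode mul_row_col mul0mx !addr0 mxE.
  rewrite !big_ord_recl big_ord0 !mxE/= -{3}(pos_partB y); ring.
have [net [dn sn rn]] := machine_product _ _ ws q (fun y x => c * chain ws qs y x) IH.
exists net; split=> //.
by apply: (leq_trans sn); rewrite addnA -mulnDl -mulSn.
Qed.

(** One more layer in front sets the accumulator to 1 and splits the input into positive and
    negative parts. *)
Lemma chain_net ws qs (c : R) : net_computes d (size qs * (size ws + 3)).+1
  ((size qs * (size ws + 3)).+2 * layer_cost) (fun x => c * chain ws qs 1 x).
Proof.
have [net [dn sn rn]] := machine_chain ws qs c.
pose W : 'M[R]_(6 + (d + d), d) := col_mx 0 (col_mx 1%:M (- 1%:M)).
pose b : 'cV[R]_(6 + (d + d)) := col_mx (loop_state (0, 0, 1)) 0.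
exists (@Hidden R 1 d (5 + (d + d)) W b net); split=> /=.
- by rewrite dn.
- have h1 := nb_nonzero_le _ _ W; have h2 := nb_nonzero_le _ _ b.
  apply: (leq_trans (leq_add (leq_add h1 h2) sn)).
  by rewrite /layer_cost; nia.
- move=> x; rewrite -(rn (0, 0, 1) x); congr (realize net _ 0 0).
  have r0 : relu (loop_state (0, 0, 1)) = loop_state (0, 0, 1).
    rewrite /loop_state relu_vec /=; congr vec; congr [:: _; _; _; _; _; _];
      by rewrite /pos_part; apply/max_idPl; rewrite le_max lexx orbT.
  have e : relu (col_mx 0 (col_mx 1%:M (- 1%:M)) *m x + col_mx (loop_state (0, 0, 1)) 0) =
      encode (loop_state (0, 0, 1)) x.
    rewrite !mul_col_mx !add_col_mx mul0mx add0r mul1mx mulNmx mul1mx addr0.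
    by rewrite !relu_col r0.
  exact: e.
Qed.

End register_machine.

(** * Accuracy of products, hat functions *)

Section product_accuracy.
Context {R : realType}.
Implicit Types (t y u a b : R).

Lemma pos_part_ge t : 0 <= t -> pos_part t = t.
Proof. by move=> t0; apply/max_idPl. Qed.

Lemma pos_part_le t : t <= 0 -> pos_part t = 0.
Proof. by move=> t0; apply/max_idPr. Qed.

(* With g t = t - t^2, the identity 4 g t = tent t + g (tent t) on [0, 1] expands
   t^2 as t minus the sum of the iterated tents of t divided by powers of 4. *)
Lemma tent_parabola t : 0 <= t <= 1 ->
  0 <= tent t <= 1 /\ 4 * (t - t ^+ 2) = tent t + (tent t - tent t ^+ 2).
Proof.
move=> /andP[t0 t1]; rewrite /tent (pos_part_ge t)//.
have [th|th] := leP t 2^-1.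
  by rewrite pos_part_le; [split; [lra|ring]|lra].
by rewrite pos_part_ge; [split; [lra|field]|lra].
Qed.

Definition tent_weights k s : seq R := [seq 4^-1 ^+ i.+1 | i <- iota k s].

(** [al] and [be] are the remainders of the two expansions. Their signs and first upper bounds
    confine the approximate squares, and the bounds at k + s give the accuracy. *)
Lemma tent_loop_weights s k a b y : 0 <= a <= 1 -> 0 <= b <= 1 ->
  exists al be, [/\ (tent_loop (tent_weights k s) (a, b, y)).2 =
      y - 4^-1 ^+ k * ((a - a ^+ 2) - (b - b ^+ 2)) + (al - be),
    0 <= al <= 4^-1 ^+ k * (a - a ^+ 2), 0 <= be <= 4^-1 ^+ k * (b - b ^+ 2),
    al <= 4^-1 ^+ (k + s) & be <= 4^-1 ^+ (k + s)].
Proof.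
elim: s k a b y => [|s IH] k a b y a01 b01.
  exists (4^-1 ^+ k * (a - a ^+ 2)), (4^-1 ^+ k * (b - b ^+ 2)); rewrite addn0 /=.
  have k0 : 0 <= (4^-1 : R) ^+ k by rewrite exprn_ge0// invr_ge0.
  by split; [ring| | | |]; rewrite ?lexx ?andbT ?mulr_ge0 ?ler_piMr//; nra.
have [Ta ea] := tent_parabola a a01; have [Tb eb] := tent_parabola b b01.
have [al [be [e al0 be0 als bes]]] :=
  IH k.+1 (tent a) (tent b) (y - 4^-1 ^+ k.+1 * (tent a - tent b)) Ta Tb.
exists al, be; rewrite addnS -addSn; split=> //.
- rewrite [LHS]e; congr (_ + _).
  have -> : a - a ^+ 2 = (tent a + (tent a - tent a ^+ 2)) / 4 by rewrite -ea; field.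
  have -> : b - b ^+ 2 = (tent b + (tent b - tent b ^+ 2)) / 4 by rewrite -eb; field.
  by rewrite exprS; field.
- case/andP: al0 => -> /= /le_trans; apply; rewrite exprSr -mulrA.
  rewrite ler_wpM2l ?exprn_ge0 ?invr_ge0//; lra.
- case/andP: be0 => -> /= /le_trans; apply; rewrite exprSr -mulrA.
  rewrite ler_wpM2l ?exprn_ge0 ?invr_ge0//; lra.
Qed.

(** The approximate squares a^2 + al and b^2 + be lie in [a^2, a] and [b^2, b], so their difference
    stays in [-1, 1] and can enter the next product. *)
Lemma product_net_accuracy s y u : `|y| <= 1 -> `|u| <= 1 ->
  `|product_net (tent_weights 0 s) y u - y * u| <= 4^-1 ^+ s /\
  `|product_net (tent_weights 0 s) y u| <= 1.
Proof.
move=> y1 u1; rewrite /product_net.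
set a := `|y + u| / 2; set b := `|y - u| / 2.
have a01 : 0 <= a <= 1.
  by rewrite /a divr_ge0//=; have := ler_normD y u; lra.
have b01 : 0 <= b <= 1.
  by rewrite /b divr_ge0//=; have := ler_normB y u; lra.
have [al [be [-> + +]]] := tent_loop_weights s 0 a b (a - b) a01 b01.
rewrite expr0 !mul1r add0n => al0 be0 als bes.
have yuE : y * u = a ^+ 2 - b ^+ 2.
  by rewrite /a /b !expr_div_n !real_normK ?num_real//; field.
rewrite yuE; split; rewrite ler_norml; apply/andP; split; nra.
Qed.

(** Errors add up without amplification because every later factor is at most 1 in modulus. *)
Lemma chain_accuracy d s (qs : seq (ridge d)) y (x : 'cV[R]_d) : `|y| <= 1 ->
  all (fun q => `|ridge_eval d q x| <= 1) qs ->
  `|chain d (tent_weights 0 s) qs y x - y * \prod_(q <- qs) ridge_eval d q x| <=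
  (size qs)%:R * 4^-1 ^+ s.
Proof.
elim: qs y => [|q qs IH] y y1 /=.
  by move=> _; rewrite big_nil mulr1 subrr normr0 mul0r.
move=> /andP[q1 qs1]; have [h1 h2] := product_net_accuracy s y _ y1 q1.
have := IH _ h2 qs1; rewrite big_cons.
set u := ridge_eval d q x in q1 h1 h2 *; set y' := product_net _ _ _ in h1 h2 *.
set P := \prod_(_ <- _) _.
have P1 : `|P| <= 1.
  rewrite /P; elim: qs qs1 {IH P} => [|p qs IH]; first by rewrite big_nil normr1.
  by move=> /andP[p1 qs1]; rewrite big_cons normrM mulr_ile1//; exact: IH.
move=> h3; have -> : chain d (tent_weights 0 s) qs y' x - y * (u * P) =
  (chain d (tent_weights 0 s) qs y' x - y' * P) + (y' - y * u) * P by ring.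
apply: (le_trans (ler_normD _ _)); rewrite -natr1 [leRHS]mulrDl mul1r.
apply: lerD => //; rewrite normrM; apply: (le_trans _ h1).
by rewrite ler_piMr.
Qed.

End product_accuracy.

Section hats.
Context {R : realType}.
Implicit Types (t : R).

Definition hat t : R := pos_part (t + 1) - 2 * pos_part t + pos_part (t - 1).

(** Newton factors are unbounded away from their cube, while products need factors in [-1, 1];
    clipping changes nothing on the support of the hats. *)
Definition clip t : R := pos_part (t + 1) - pos_part (t - 1) - 1.

(** A hat is a difference of two consecutive shifts of a ramp, so sums of shifted hats telescope. *)
Definition ramp t : R := pos_part (t + 1) - pos_part t.

Lemma rampP t : 0 <= ramp t <= 1.
Proof.
rewrite /ramp; have [t0|t0] := leP 0 t; first by rewrite !pos_part_ge; lra.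
rewrite (pos_part_le t (ltW t0)); have [t1|t1] := leP 0 (t + 1).
  by rewrite pos_part_ge; lra.
by rewrite pos_part_le; lra.
Qed.

Lemma hat_ramp t : hat t = ramp t - ramp (t - 1).
Proof. by rewrite /hat /ramp subrK; ring. Qed.

Lemma hatP t : 0 <= hat t <= 1.
Proof.
rewrite /hat; have [t1|t1] := leP 1 t; first by rewrite !pos_part_ge; lra.
have -> : pos_part (t - 1) = 0 by rewrite pos_part_le; lra.
have [t0|t0] := leP 0 t; first by rewrite !pos_part_ge; lra.
rewrite (pos_part_le t (ltW t0)); have [t2|t2] := leP 0 (t + 1).
  by rewrite pos_part_ge; lra.
by rewrite pos_part_le; lra.
Qed.

Lemma hat_outside t : 1 <= `|t| -> hat t = 0.
Proof.
rewrite ler_normr => /orP[t1|t1]; rewrite /hat; first by rewrite !pos_part_ge; lra.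
by rewrite !pos_part_le; lra.
Qed.

Lemma clip_le1 t : `|clip t| <= 1.
Proof.
rewrite /clip; have [t1|t1] := leP 1 t.
  by rewrite !pos_part_ge ?ler_norml; lra.
have -> : pos_part (t - 1) = 0 by rewrite pos_part_le; lra.
have [t2|t2] := leP 0 (t + 1); first by rewrite pos_part_ge ?ler_norml; lra.
by rewrite pos_part_le ?ler_norml; lra.
Qed.

Lemma clip_id t : `|t| <= 1 -> clip t = t.
Proof.
rewrite ler_norml => t1; rewrite /clip pos_part_ge; last lra.
by rewrite pos_part_le; lra.
Qed.

Lemma hat_sum n t :
  \sum_(k < n) hat (t - k%:R) = ramp t - ramp (t - n%:R).
Proof.
elim: n => [|n IH]; first by rewrite big_ord0 subr0 subrr.
have -> : t - n.+1%:R = t - n%:R - 1 by rewrite -natr1 opprD addrA.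
by rewrite big_ord_recr/= IH hat_ramp; ring.
Qed.

Lemma hat_sum_le1 n t : \sum_(k < n) hat (t - k%:R) <= 1.
Proof.
by rewrite hat_sum; have := rampP t; have := rampP (t - n%:R); lra.
Qed.

Lemma hat_sum_eq1 n t : 0 <= t <= n%:R - 1 -> \sum_(k < n) hat (t - k%:R) = 1.
Proof.
move=> tn; rewrite hat_sum /ramp (pos_part_ge (t + 1)) ?(pos_part_ge t); try lra.
by rewrite !pos_part_le; lra.
Qed.

Variable d : nat.

Definition coordinate_ridge (j : 'I_d) (k : R) (b c : seq R) (sh : R) : ridge d :=
  Ridge d (\matrix_(i, l) (k *+ (l == j))) (vec 3 b) (vec 3 c)^T sh.

Lemma coordinate_ridgeE j k b0 b1 b2 c0 c1 c2 sh (x : 'cV[R]_d) :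
  ridge_eval d (coordinate_ridge j k [:: b0; b1; b2] [:: c0; c1; c2] sh) x =
  c0 * pos_part (k * x j 0 + b0) + c1 * pos_part (k * x j 0 + b1) +
  c2 * pos_part (k * x j 0 + b2) + sh.
Proof.
rewrite /ridge_eval mxE; congr (_ + _).
rewrite !big_ord_recl big_ord0 addr0 !mxE /= !addrA.
suff e i : \sum_l (\matrix_(i, l) (k *+ (l == j)) : 'M[R]_(3, d)) i l * x l 0 = k * x j 0.
  by rewrite !e.
rewrite (bigD1 j)//= big1 => [|l lj]; first by rewrite mxE eqxx addr0.
by rewrite mxE (negPf lj) mul0r.
Qed.

Definition hat_ridge (j : 'I_d) (q h : R) : ridge d :=
  coordinate_ridge j h^-1 [:: 1 - q / h; - (q / h); - 1 - q / h] [:: 1; -2; 1] 0.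

Lemma hat_ridgeE j q h (x : 'cV[R]_d) :
  ridge_eval d (hat_ridge j q h) x = hat ((x j 0 - q) / h).
Proof.
rewrite coordinate_ridgeE /hat addr0 mulrBl [_^-1 * _]mulrC !mul1r mulNr.
by congr (pos_part _ - 2 * pos_part _ + pos_part _); ring.
Qed.

Definition clip_ridge (j : 'I_d) (q h : R) : ridge d :=
  coordinate_ridge j h^-1 [:: 1 - q / h; - 1 - q / h; 0] [:: 1; -1; 0] (-1).

Lemma clip_ridgeE j q h (x : 'cV[R]_d) :
  ridge_eval d (clip_ridge j q h) x = clip ((x j 0 - q) / h).
Proof.
rewrite coordinate_ridgeE /clip mul0r addr0 mulrBl [_^-1 * _]mulrC !mul1r !mulN1r.
by congr (pos_part _ - pos_part _ - 1); ring.
Qed.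

End hats.

(** * The Gaussian norm *)

Section exp_abs.
Context {R : realType}.
Notation leb := (@lebesgue_measure R).

Lemma continuous_exp_abs (c : R) : continuous (fun x : R => expR (- c * `|x|)).
Proof.
move=> x; apply: continuous_comp; last exact: continuous_expR.
by apply: continuousM; [exact: cst_continuous|exact: norm_continuous].
Qed.

Lemma measurable_exp_abs (c : R) :
  measurable_fun [set: R] (fun x : R => expR (- c * `|x|)).
Proof. exact: continuous_measurable_fun (@continuous_exp_abs c). Qed.

Lemma integral_exp_abs_half (c : R) : 0 < c ->
  (\int[leb]_(x in `[0%R, +oo[) (expR (- c * `|x|))%:E < +oo)%E.
Proof.
move=> c0; have mE := measurable_exponential_pdf c.
have -> : (\int[leb]_(x in `[0%R, +oo[) (expR (- c * `|x|))%:E =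
    \int[leb]_(x in `[0%R, +oo[) (c^-1%:E * (exponential_pdf c x)%:E))%E.
  apply: eq_integral => x; rewrite inE/= in_itv/= andbT => x0.
  by rewrite -EFinM exponential_pdfE// ger0_norm// mulKf// gt_eqF.
apply: (@le_lt_trans _ _ (\int[leb]_x (c^-1%:E * (exponential_pdf c x)%:E))%E).
  apply: ge0_subset_integral => //.
    by apply: measurable_funeM; apply/measurable_EFinP.
  by move=> x _; rewrite lee_fin mulr_ge0 ?invr_ge0 ?exponential_pdf_ge0 ?ltW.
rewrite ge0_integralZl//.
- by rewrite integral_exponential_pdf// mule1 ltry.
- exact/measurable_EFinP.
- by move=> x _; rewrite lee_fin exponential_pdf_ge0// ltW.
- by rewrite lee_fin invr_ge0 ltW.
Qed.

Lemma integral_exp_abs (c : R) : 0 < c ->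
  (\int[leb]_x (expR (- c * `|x|))%:E < +oo)%E.
Proof.
move=> c0; have mf : measurable_fun setT (EFin \o (fun x : R => expR (- c * `|x|))).
  by apply/measurable_EFinP; exact: measurable_exp_abs.
rewrite -(setUv `[0, +oo[%classic) ge0_integral_setU//=; try
  by [exact: measurableC|rewrite setUv|move=> x _; rewrite lee_fin expR_ge0|exact/disj_setPCl].
apply: lte_add_pinfty; first exact: integral_exp_abs_half.
apply: (@le_lt_trans _ _ (\int[leb]_(x in `]-oo, (- 0)%R]) (expR (- c * `|x|))%:E)%E).
  apply: ge0_subset_integral => //.
  - exact: measurableC.
  - exact: measurable_funTS.
  - by move=> x /=; rewrite !in_itv/= andbT oppr0 => /negP; rewrite -ltNge => /ltW.
rewrite (@ge0_integration_by_substitutionNy _ (fun x => expR (- c * `|x|))).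
- under eq_integral do rewrite /= normrN.
  exact: integral_exp_abs_half.
- by apply: continuous_subspaceT; exact: continuous_exp_abs.
- by move=> x _; exact: expR_ge0.
Qed.

End exp_abs.

(** * Lebesgue measure on tuples: sigma-finiteness and Tonelli *)

Section lebesgue_tuple_integral.
Context {R : realType}.
Notation leb := (@lebesgue_measure R).

Definition cube n (k : nat) : set (n.-tuple R) :=
  [set t | forall i, `|tnth t i| <= k%:R].

Lemma measurable_cube n k : measurable (cube n k).
Proof.
have -> : cube n k = \bigcap_(i in [set: 'I_n]) ((fun t => tnth t i) @^-1` `[- k%:R, k%:R]).
  apply/seteqP; split => t /= h i; first by move=> _ /=; rewrite in_itv/= -ler_norml.
  by have := h i I; rewrite /= in_itv/= -ler_norml.
apply: fin_bigcap_measurable => [|i _]; first exact: finite_finset.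
rewrite -[X in measurable X]setTI.
exact: measurable_tnth.
Qed.

Lemma preimage_cube n k : @pair_cons R n @^-1` cube n.+1 k =
  cube n k `*` `[- k%:R, k%:R].
Proof.
apply/seteqP; split => -[t x] /=.
  move=> h; split => /= [i|].
    by have := h (lift ord0 i); rewrite /pair_cons tnthS.
  by have := h ord0; rewrite /pair_cons tnth0 in_itv/= -ler_norml.
move=> [/= ht hx] i; case: (unliftP ord0 i) => [j ->|->].
  by rewrite /pair_cons tnthS.
by rewrite /pair_cons tnth0; rewrite in_itv/= -ler_norml in hx.
Qed.

Lemma lebesgue_tuple_cube n k : (lebesgue_tuple R n (cube n k) < +oo)%E.
Proof.
elim: n => [|n IH]; first by rewrite /= diracE ltry.
rewrite /= /lebesgue_cons /pushforward preimage_cube product_measure1E//; last first.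
  exact: measurable_cube.
rewrite lte_mul_pinfty//; last first.
  by rewrite [X in (X < _)%E]lebesgue_measure_itv/=; case: ifP => _; rewrite ?ltry.
by rewrite ge0_fin_numE.
Qed.

Lemma sigma_finite_lebesgue_tuple n : sigma_finite setT (lebesgue_tuple R n).
Proof.
exists (cube n) => [|k]; last by split; [exact: measurable_cube|exact: lebesgue_tuple_cube].
apply/esym/seteqP; split => // t _.
exists (Num.truncn (\sum_i `|tnth t i|)).+1 => // i.
apply: (@le_trans _ _ (\sum_i `|tnth t i|)); last exact/ltW/truncnS_gt.
by rewrite (bigD1 i)//= lerDl sumr_ge0.
Qed.

Lemma measurable_exp_abs_sum n (c : R) : measurable_fun [set: n.-tuple R]
  (fun t => expR (- c * \sum_(j < n) `|tnth t j|)).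
Proof.
apply: measurableT_comp => //; apply: measurable_funM => //.
apply: measurable_sum => j; apply: measurableT_comp => //; exact: measurable_tnth.
Qed.

Lemma integral_lebesgue_tupleS n (f : n.+1.-tuple R -> \bar R) :
  measurable_fun setT f -> (forall t, 0 <= f t)%E ->
  (\int[lebesgue_tuple R n.+1]_t f t =
   \int[lebesgue_tuple R n]_t \int[leb]_x f (pair_cons (t, x)))%E.
Proof.
move=> mf f0; pose X : measurableType _ := (n.-tuple R * measurableTypeR R)%type.
have mp : measurable_fun [set: X] (@pair_cons R n : X -> n.+1.-tuple R).
  exact: measurable_pair_cons.
have mfc := measurableT_comp mf mp.
pose m : {measure set X -> \bar R} := [the {measure set _ -> \bar R} of (lebesgue_tuple R n \x leb)%E].
have e := ge0_integral_pushforward mp m measurableT mf (fun t _ => f0 t).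
apply: (etrans e).
(* [lebesgue_tuple] is declared as a bare measure; it is repacked here as a sigma-finite one for
   Tonelli. *)
pose h1 := isSigmaFinite.Build _ _ _ _ (sigma_finite_lebesgue_tuple n).
pose h2 := isSFinite.Build _ _ _ _
  (sfinite_measure_sigma_finite (sigma_finite_lebesgue_tuple n)).
pose l : {measure set (n.-tuple R) -> \bar R} := lebesgue_tuple R n.
pose s := HB.pack_for (SigmaFiniteMeasure.type (n.-tuple R) R) (Measure.sort l) h1 h2.
have e2 := fubini_tonelli1 (m1 := s) (m2 := leb) _ mfc (fun z => f0 (pair_cons z)).
exact: e2.
Qed.

Lemma integral_exp_abs_tuple n (c : R) : 0 < c ->
  (\int[lebesgue_tuple R n]_t (expR (- c * \sum_(j < n) `|tnth t j|))%:E < +oo)%E.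
Proof.
move=> c0; elim: n => [|n IH].
  rewrite integral_dirac//; first by rewrite diracE in_setT mul1e ltry.
  by apply/measurable_EFinP; exact: measurable_exp_abs_sum.
rewrite integral_lebesgue_tupleS; try by
  [apply/measurable_EFinP; exact: measurable_exp_abs_sum|move=> t; rewrite lee_fin expR_ge0].
have K0 : (0 <= \int[leb]_x (expR (- c * `|x|))%:E)%E.
  by apply: integral_ge0 => x _; rewrite lee_fin expR_ge0.
have K1 := integral_exp_abs c c0.
have inner (t : n.-tuple R) :
    (\int[leb]_x (expR (- c * \sum_(j < n.+1) `|tnth (pair_cons (t, x)) j|))%:E =
     (expR (- c * \sum_(j < n) `|tnth t j|))%:E * \int[leb]_x (expR (- c * `|x|))%:E)%E.
  rewrite -ge0_integralZl//; try by [apply/measurable_EFinP; exact: measurable_exp_abs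
    |move=> x _; rewrite lee_fin expR_ge0|rewrite lee_fin expR_ge0].
  apply: eq_integral => x _; rewrite -EFinM -expRD big_ord_recl/=; congr (expR _)%:E.
  rewrite mulrDr addrC; congr (_ * _ + _ * _).
  by apply: eq_bigr => j _; rewrite /pair_cons tnthS.
under eq_integral do rewrite inner.
rewrite ge0_integralZr//; try by
  [apply/measurable_EFinP; exact: measurable_exp_abs_sum|move=> t _; rewrite lee_fin expR_ge0].
have I0 : (0 <= \int[lebesgue_tuple R n]_t (expR (- c * \sum_(j < n) `|tnth t j|))%:E)%E.
  by apply: integral_ge0 => t _; rewrite lee_fin expR_ge0.
by apply: lte_mul_pinfty => //; rewrite ge0_fin_numE.
Qed.

End lebesgue_tuple_integral.

(** * Integrals against the Gaussian measure *)

Section gaussian_density.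
Context {R : realType}.
Variable d : nat.
Notation leb := (lebesgue_tuple R d).

Import HBNNSimple.

Lemma sintegral_gaussian (h : {nnsfun d.-tuple R >-> R}) :
  (sintegral (@gaussian R d) h = \int[leb]_t (h t * gaussian_pdf t)%:E)%E.
Proof.
have mpdf := @measurable_gaussian_pdf R d.
transitivity (\int[leb]_t (\sum_(r \in range h)
    (r * \1_(h @^-1` [set r]) t * gaussian_pdf t)%:E))%E; last first.
  apply: eq_integral => t _; rewrite EFinM (fimfunE h t) -fsumEFin//.
  rewrite ge0_mule_fsuml; last by move=> r; exact: nnfun_muleindic_ge0.
  by apply: eq_fsbigr => r _; rewrite EFinM.
rewrite ge0_integral_fsum//; try by [
  move=> r; apply/measurable_EFinP; apply: measurable_funM => //; exact: measurable_funM |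
  move=> r t _; rewrite EFinM mule_ge0 ?lee_fin ?gaussian_pdf_ge0//; exact: nnfun_muleindic_ge0 |
  exact: fimfunP].
rewrite sintegralE; apply: eq_fsbigr => r /set_mem[t0 _ <-].
have mh : measurable (h @^-1` [set h t0]) by exact: measurable_sfunP.
transitivity (\int[leb]_t ((h t0)%:E * ((\1_(h @^-1` [set h t0]) t)%:E * (gaussian_pdf t)%:E)))%E.
  rewrite ge0_integralZl//.
  - congr (_ * _)%E; rewrite [LHS]integral_mkcond; apply: eq_integral => t _.
    by rewrite patchE indicE; case: ifPn => _; rewrite ?mul1e ?mul0e.
  - apply/measurable_EFinP; apply: measurable_funM => //; exact: measurable_gaussian_pdf.
  - by move=> t _; rewrite -EFinM lee_fin mulr_ge0 ?gaussian_pdf_ge0.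
  - by rewrite lee_fin; exact: fun_ge0.
by apply: eq_integral => t _; rewrite -!EFinM mulrA.
Qed.

(** The integral of f is a supremum over simple functions below f, and these lie below m. Only the
    majorant has to be measurable, so the measurability of f and of the networks never comes up. *)
Lemma ge0_integral_gaussian_le (f : d.-tuple R -> \bar R) (m : d.-tuple R -> R) :
  (forall t, 0 <= f t)%E -> (forall t, f t <= (m t)%:E)%E -> measurable_fun setT m ->
  (\int[@gaussian R d]_t f t <= \int[leb]_t (m t * gaussian_pdf t)%:E)%E.
Proof.
move=> f0 fm mm; rewrite ge0_integralTE//; apply: ge_ereal_sup => _ [h hf <-].
rewrite sintegral_gaussian; apply: ge0_le_integral => //.
- by move=> t _; rewrite lee_fin mulr_ge0 ?gaussian_pdf_ge0.
- apply/measurable_EFinP; apply: measurable_funM => //; exact: measurable_gaussian_pdf.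
- apply/measurable_EFinP; apply: measurable_funM => //; exact: measurable_gaussian_pdf.
- move=> t _; rewrite lee_fin ler_wpM2r ?gaussian_pdf_ge0// -lee_fin.
  exact: le_trans (hf t) (fm t).
Qed.

(** The square of exp(x^2/4) cancels the Gaussian density up to its constant, and exp(- 2 k |x|)
    remains, which is integrable. K does not depend on g, hence not on n later. *)
Lemma gaussian_L2_le (k : R) : 0 < k -> exists K : R, 0 <= K /\
  forall (A : R) (g : 'cV[R]_d -> R), 0 <= A ->
  (forall x, `|g x| <= A * expR (\sum_(j < d) (x j 0 ^+ 2 / 4 - k * `|x j 0|))) ->
  (gaussian_L2 g <= (A * K)%:E)%E.
Proof.
move=> k0; have k20 : 0 < 2 * k by rewrite mulr_gt0.
have := integral_exp_abs_tuple d (2 * k) k20; set I := (\int[_]_t _)%E => Ioo.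
have I0 : (0 <= I)%E by apply: integral_ge0 => t _; rewrite lee_fin expR_ge0.
pose c : R := (2 * pi) `^ (- (d%:R / 2)).
exists (Num.sqrt (c * fine I)); split; first exact: sqrtr_ge0.
move=> A g A0 gA; rewrite /gaussian_L2 unlock.
under eq_integral do rewrite abse_EFin poweR_EFin.
have c0 : 0 <= c by exact: powR_ge0.
have -> : A * Num.sqrt (c * fine I) = (A ^+ 2 * (c * fine I)) `^ 2^-1.
  by rewrite powR12_sqrt ?mulr_ge0 ?sqr_ge0 ?fine_ge0// [in RHS]sqrtrM ?sqr_ge0// sqrtr_sqr ger0_norm.
rewrite -poweR_EFin; apply: gt0_ler_poweR; rewrite ?invr_ge0//.
- by rewrite in_itv/= leey andbT; apply: integral_ge0 => t _; rewrite lee_fin powR_ge0.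
- by rewrite in_itv/= leey andbT lee_fin !mulr_ge0 ?sqr_ge0 ?fine_ge0.
pose m (t : d.-tuple R) :=
  A ^+ 2 * expR (\sum_(j < d) (tnth t j ^+ 2 / 2 - 2 * k * `|tnth t j|)).
apply: (le_trans (ge0_integral_gaussian_le (fun t => (`|g (col_of_tuple t)| `^ 2)%:E) m _ _ _)).
- by move=> t; rewrite lee_fin powR_ge0.
- move=> t; rewrite lee_fin powR_mulrn//.
  apply: (@le_trans _ _ ((A * expR (\sum_(j < d) (tnth t j ^+ 2 / 4 - k * `|tnth t j|))) ^+ 2)).
    rewrite ler_sqr ?nnegrE ?mulr_ge0 ?expR_ge0//; apply: (le_trans (gA _)).
    rewrite ler_wpM2l// ler_expR; apply: ler_sum => j _; by rewrite !mxE.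
  rewrite exprMn /m ler_wpM2l ?sqr_ge0// -expRM_natl ler_expR mulr_sumr.
  by apply: ler_sum => j _; lra.
- apply: measurable_funM => //; apply: measurableT_comp => //.
  apply: measurable_sum => j; apply: measurable_funB.
    by apply: measurable_funM => //; apply: measurable_funX; exact: measurable_tnth.
  apply: measurable_funM => //; apply: measurableT_comp => //; exact: measurable_tnth.
have -> : (\int[leb]_t (m t * gaussian_pdf t)%:E =
    \int[leb]_t ((A ^+ 2 * c)%:E * (expR (- (2 * k) * \sum_(j < d) `|tnth t j|))%:E))%E.
  apply: eq_integral => t _; rewrite -EFinM; congr (_%:E).
  rewrite /m /gaussian_pdf -/c mulrACA -expRD; congr (_ * expR _).
  by rewrite sumrB -mulr_suml -mulr_sumr; lra.
rewrite ge0_integralZl//.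
- by rewrite -/I -[X in (_ * X)%E]fineK ?ge0_fin_numE// -EFinM mulrA lexx.
- by apply/measurable_EFinP; exact: measurable_exp_abs_sum.
- by rewrite lee_fin mulr_ge0 ?sqr_ge0.
Qed.

End gaussian_density.

(** * Partition of unity and assembly *)

Section partition_of_unity.
Context {R : realType} (d : nat).
Variables (h : R) (n : nat).
Notation index := {ffun 'I_d -> 'I_(2 * n + 1)}.
Implicit Types (x : 'cV[R]_d) (Q : index).

Definition centre Q (j : 'I_d) : R := ((Q j)%:R - n%:R) * h.

Definition tensor_hat Q x : R := \prod_j hat ((x j 0 - centre Q j) / h).

Lemma tensor_hat_ge0 Q x : 0 <= tensor_hat Q x.
Proof. by apply: prodr_ge0 => j _; have /andP[] := hatP ((x j 0 - centre Q j) / h). Qed.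

Lemma tensor_hat_support Q x : 0 < h -> tensor_hat Q x != 0 ->
  forall j, `|x j 0 - centre Q j| <= h.
Proof.
move=> h0 + j; apply: contraNT; rewrite -ltNge => hx.
rewrite /tensor_hat (bigD1 j)//= hat_outside ?mul0r//.
by rewrite normrM normfV (gtr0_norm h0) ler_pdivlMr// mul1r ltW.
Qed.

Lemma centre_bound Q j : 0 <= h -> `|centre Q j| <= n%:R * h.
Proof.
move=> h0; rewrite /centre normrM (ger0_norm h0) ler_wpM2r// ler_norml.
have : (Q j <= 2 * n)%N by rewrite -ltnS; apply: leq_trans (ltn_ord (Q j)) _; rewrite addn1.
rewrite -(ler_nat R) natrM => Qn; have : 0 <= (Q j)%:R :> R by rewrite ler0n.
by move=> Q0; apply/andP; split; lra.
Qed.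

Lemma tensor_hat_sum x : 0 < h ->
  \sum_Q tensor_hat Q x = \prod_j \sum_(i < 2 * n + 1) hat (x j 0 / h + n%:R - i%:R).
Proof.
move=> h0; rewrite bigA_distr_bigA; apply: eq_bigr => Q _.
apply: eq_bigr => j _; congr hat; rewrite /centre; field.
by rewrite gt_eqF.
Qed.

Lemma tensor_hat_sum_le1 x : 0 < h -> \sum_Q tensor_hat Q x <= 1.
Proof.
move=> h0; rewrite tensor_hat_sum//; apply: prodr_ile1 => j _.
rewrite hat_sum_le1 andbT; apply: sumr_ge0 => i _.
by have /andP[] := hatP (x j 0 / h + n%:R - i%:R).
Qed.

Lemma tensor_hat_sum_eq1 x : 0 < h -> (forall j, `|x j 0| <= n%:R * h) ->
  \sum_Q tensor_hat Q x = 1.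
Proof.
move=> h0 xn; rewrite tensor_hat_sum// big1// => j _; apply: hat_sum_eq1.
rewrite natrD natrM; have := xn j; rewrite -ler_pdivrMr//.
have -> : `|x j 0| / h = `|x j 0 / h| by rewrite normrM normfV (gtr0_norm h0).
by rewrite ler_norml => /andP[? ?]; apply/andP; split; lra.
Qed.

End partition_of_unity.

Section piece.
Context {R : realType} (d : nat).
Variables (j0 : 'I_d) (a : R) (m : nat).
Implicit Types (x : 'cV[R]_d) (q : 'I_d -> R) (l : seq (nat * R)).

Definition unit_ridge : @ridge R d := Ridge d 0 0 0 1.

Lemma unit_ridgeE x : ridge_eval d unit_ridge x = 1.
Proof. by rewrite /ridge_eval /= mul0mx mxE add0r. Qed.

(** [j0] is the default value of the conversion from natural numbers to coordinates. *)
Definition newton_ridge q (s : nat * R) : @ridge R d :=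
  let j := insubd j0 s.1 in clip_ridge d j (q j + s.2) (a / 44).

(* Padding with units gives all pieces the same number of factors, hence networks
   of the same depth. *)
Definition piece_factors q l : seq (@ridge R d) :=
  [seq hat_ridge d j (q j) (a / 88) | j <- enum 'I_d] ++
  take m ([seq newton_ridge q s | s <- l] ++ nseq m unit_ridge).

Lemma size_piece_factors q l : size (piece_factors q l) = (d + m)%N.
Proof.
rewrite size_cat size_map size_enum_ord size_takel// size_cat size_nseq.
exact: leq_addl.
Qed.

Lemma piece_factors_le1 q l x :
  all (fun r => `|ridge_eval d r x| <= 1) (piece_factors q l).
Proof.
rewrite all_cat; apply/andP; split.
  rewrite all_map; apply/allP => j _ /=; rewrite hat_ridgeE.
  by have /andP[? ?] := hatP ((x j 0 - q j) / (a / 88)); rewrite ger0_norm.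
have : all (fun r => `|ridge_eval d r x| <= 1)
    ([seq newton_ridge q s | s <- l] ++ nseq m unit_ridge).
  rewrite all_cat all_nseq unit_ridgeE normr1 lexx orbT andbT all_map.
  by apply/allP => s _ /=; rewrite clip_ridgeE clip_le1.
by rewrite -{1}(cat_take_drop m (_ ++ _)) all_cat => /andP[].
Qed.

(** True for every x: outside the cube a hat makes both sides vanish, and inside it |x j - q j -
    node| <= a/88 + a/88, so every clip is the identity. *)
Lemma piece_factors_prod q l x : 0 < a -> (size l <= m)%N ->
  (forall s, s \in l -> (s.1 < d)%N && (`|s.2| <= a / 88)) ->
  \prod_(r <- piece_factors q l) ridge_eval d r x =
  \prod_j hat ((x j 0 - q j) / (a / 88)) * newton_monomial a (displacement d q x) l.
Proof.
move=> a0 lm lP; rewrite big_cat/= big_map big_enum/=.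
under eq_bigr do rewrite hat_ridgeE.
have [->|bx] := eqVneq (\prod_j hat ((x j 0 - q j) / (a / 88))) 0.
  by rewrite !mul0r.
have xq j : `|x j 0 - q j| <= a / 88.
  rewrite leNgt; apply: contra bx => hx; rewrite (bigD1 j)//= hat_outside ?mul0r//.
  by rewrite normrM normfV [X in _ / X]gtr0_norm ?divr_gt0// ler_pdivlMr ?divr_gt0// mul1r ltW.
congr (_ * _); rewrite take_cat size_map ltnNge lm/= take_nseq ?leq_subr//.
have units k : \prod_(r <- nseq k unit_ridge) ridge_eval d r x = 1.
  by elim: k => [|k IH]; rewrite ?big_nil//= big_cons IH unit_ridgeE mulr1.
rewrite big_cat/= units mulr1.
rewrite big_map /newton_monomial big_seq [RHS]big_seq; apply: eq_bigr => s /lP/andP[sd sa].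
rewrite clip_ridgeE /newton_factor; set j := insubd _ _.
have js : s.1 = j by rewrite /j insubdK.
rewrite js displacementE opprD addrA clip_id//.
rewrite normrM normfV [X in _ / X]gtr0_norm ?divr_gt0// ler_pdivrMr ?divr_gt0// mul1r.
have := ler_normB (x j 0 - q j) s.2; have := xq j; lra.
Qed.

End piece.

Section assembly.
Context {R : realType} (d : nat).
Variables (j0 : 'I_d) (a : R) (n m s N : nat).
Notation index := {ffun 'I_d -> 'I_(2 * n + 1)}.
Variable L : index -> seq (R * seq (nat * R)).
Hypothesis sizeL : forall Q, (size (L Q) <= N)%N.
Notation centre := (centre d (a / 88) n).
Notation tensor_hat := (tensor_hat d (a / 88) n).

Definition piece_net (u : index * (R * seq (nat * R))) (x : 'cV[R]_d) : R :=
  u.2.1 * chain d (tent_weights 0 s) (piece_factors d j0 a m (centre u.1) u.2.2) 1 x.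

Definition pieces := flatten [seq [seq (Q, p) | p <- L Q] | Q <- enum index].

Lemma size_pieces : (size pieces <= (2 * n + 1) ^ d * N)%N.
Proof.
rewrite size_flatten /shape -map_comp sumnE big_map big_enum/=.
apply: (@leq_trans (\sum_(Q : index) N)%N).
  by apply: leq_sum => Q _; rewrite /= size_map; exact: sizeL.
by rewrite sum_nat_const card_ffun !card_ord.
Qed.

Lemma sum_pieces (g : index * (R * seq (nat * R)) -> R) :
  \sum_(u <- pieces) g u = \sum_Q \sum_(p <- L Q) g (Q, p).
Proof.
rewrite big_flatten big_map big_enum/=; apply: eq_bigr => Q _.
by rewrite big_map.
Qed.

Lemma assembled_net : net_computes d ((d + m) * (s + 3)).+1
  (((2 * n + 1) ^ d * N).+1 * (((d + m) * (s + 3)).+2 * layer_cost d))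
  (fun x => \sum_(u <- pieces) piece_net u x).
Proof.
have step q l c : net_computes d ((d + m) * (s + 3)).+1
    (((d + m) * (s + 3)).+2 * layer_cost d)
    (fun x => c * chain d (tent_weights 0 s) (piece_factors d j0 a m q l) 1 x).
  have := chain_net d (tent_weights 0 s) (piece_factors d j0 a m q l) c.
  by rewrite size_piece_factors /tent_weights size_map size_iota.
have [|net [dn sn rn]] := net_computes_sum d _ _ _ pieces piece_net _
  (fun u => step (centre u.1) u.2.2 u.2.1).
  (* The zero function at the right depth: an empty piece with coefficient 0. *)
  have [net [dn sn rn]] := step (fun=> 0) [::] 0.
  by exists net; split=> // x; rewrite rn mul0r.
exists net; split=> //; apply: (leq_trans sn).
by rewrite leq_mul2r ltnS size_pieces orbT.
Qed.

Lemma assembled_error (c : R) x : 0 < a -> 0 <= c ->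
  (forall Q p, p \in L Q -> [/\ `|p.1| <= c, (size p.2 <= m)%N &
      forall r, r \in p.2 -> (r.1 < d)%N && (`|r.2| <= a / 88)]) ->
  `|\sum_(u <- pieces) piece_net u x -
    \sum_Q tensor_hat Q x * \sum_(p <- L Q) p.1 *
      newton_monomial a (displacement d (centre Q) x) p.2| <=
  ((2 * n + 1) ^ d * N)%:R * (c * ((d + m)%:R * 4^-1 ^+ s)).
Proof.
move=> a0 c0 LP; set e := c * _; have e0 : 0 <= e.
  by rewrite /e !mulr_ge0// exprn_ge0// invr_ge0.
rewrite sum_pieces -sumrB; apply: (le_trans (ler_norm_sum _ _ _)).
apply: (@le_trans _ _ (\sum_(Q : index) N%:R * e)); last first.
  by rewrite sumr_const card_ffun !card_ord -[leLHS]mulr_natl mulrA natrM.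
apply: ler_sum => Q _; rewrite mulr_sumr -sumrB.
apply: (le_trans (ler_norm_sum _ _ _)).
apply: (@le_trans _ _ (\sum_(p <- L Q) e)); last first.
  by rewrite big_const_seq count_predT iter_addr_0 -[leLHS]mulr_natl ler_wpM2r// ler_nat.
rewrite big_seq [leRHS]big_seq; apply: ler_sum => p /LP[pc pm pP].
rewrite mulrCA -(piece_factors_prod d j0 a m (centre Q) p.2 x a0 pm pP) /piece_net/=.
rewrite -mulrBr normrM; apply: ler_pM => //.
have := chain_accuracy d s (piece_factors d j0 a m (centre Q) p.2) 1 x.
rewrite normr1 lexx mul1r size_piece_factors; apply => //.
exact: piece_factors_le1.
Qed.

End assembly.

Section elementary_bounds.
Context {R : realType}.

Lemma half_exp_le n : (2^-1 : R) ^+ n <= expR (- (n%:R / 2)).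
Proof.
have -> : - (n%:R / 2) = n%:R * (- 2^-1) :> R by lra.
rewrite expRM_natl lerXn2r ?nnegrE ?invr_ge0 ?expR_ge0//.
by apply: (le_trans _ (expR_ge1Dx _)); lra.
Qed.

Lemma quarter_exp_le n : (4^-1 : R) ^+ n <= expR (- n%:R).
Proof.
have -> : (4^-1 : R) = 2^-1 ^+ 2 by rewrite expr2 -invfM; congr (_^-1); ring.
rewrite -exprM; apply: (le_trans (half_exp_le _)).
by rewrite natrM ler_expR; lra.
Qed.

Lemma nat_le_exp_sqr n : n%:R <= expR ((n ^ 2)%:R) :> R.
Proof.
apply: (@le_trans _ _ (expR n%:R)).
  by apply: (le_trans _ (expR_ge1Dx _)); rewrite lerDr.
by rewrite ler_expR ler_nat; case: n => // n; rewrite expnS leq_pmulr.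
Qed.

End elementary_bounds.

(** * Exponential rate *)

Lemma factor_count d K n : (0 < n)%N -> (d + d * (K * n) <= d * (1 + K) * n)%N.
Proof. by nia. Qed.

Lemma depth_count d K1 K2 n : (0 < n)%N ->
  (((d + d * (K1 * n)) * (K2 * n ^ 2 + 3)).+1 <= (d * (1 + K1) * (K2 + 3) + 1) * n ^ 3)%N.
Proof.
move=> n0; have sn : (K2 * n ^ 2 + 3 <= (K2 + 3) * n ^ 2)%N by nia.
rewrite [leqRHS]mulnDl mul1n -addn1; apply: leq_add; last by rewrite expn_gt0 n0.
apply: (leq_trans (leq_mul (factor_count d K1 n n0) sn)).
by rewrite [(n ^ 3)%N]expnS; apply: eq_leq; ring.
Qed.

Lemma volume_count d K n : (0 < d)%N -> (0 < n)%N ->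
  ((2 * n + 1) ^ d * (K * n) ^ d <= 3 ^ d * K ^ d * (n ^ d * n ^ d))%N.
Proof.
move=> d0 n0; rewrite expnMn -mulnACA leq_mul// -expnMn leq_exp2r//; lia.
Qed.

Section rate.
Context {R : realType} (d : nat).
Implicit Types (a k : R) (n : nat) (x : 'cV[R]_d) (q : 'I_d -> R).

Definition weight k x : R := expR (\sum_(j < d) (x j 0 ^+ 2 / 4 - k * `|x j 0|)).

(** Completing the square. It converts the absolute error of the networks into a weighted one. *)
Lemma weight_ge k x : expR (- (d%:R * k ^+ 2)) <= weight k x.
Proof.
rewrite ler_expR; apply: (@le_trans _ _ (\sum_(j < d) - k ^+ 2)).
  by rewrite sumr_const card_ord -[leRHS]mulr_natl mulrN.
apply: ler_sum => j _; have := sqr_ge0 (`|x j 0| / 2 - k).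
by rewrite sqrrB expr_div_n real_normK ?num_real//; lra.
Qed.

Lemma centre_growth a n q : 0 < a <= 2^-1 -> (0 < n)%N ->
  (forall j, `|q j| <= n%:R * (a / 88)) ->
  \sum_(j < d) (`|q j| + a) ^+ 2 / 4 <= d%:R * n%:R ^+ 2.
Proof.
move=> a01 n0 qn; have n1 : 1 <= n%:R :> R by rewrite ler1n.
apply: (@le_trans _ _ (\sum_(j < d) n%:R ^+ 2)).
  apply: ler_sum => j _; have q0 := normr_ge0 (q j); have := qn j.
  have : n%:R * (a / 88) <= n%:R by rewrite ler_piMr//; lra.
  move=> h1 h2; have : (`|q j| + a) ^+ 2 <= (2 * n%:R) ^+ 2.
    by rewrite ler_sqr ?nnegrE; lra.
  by rewrite exprMn; lra.
by rewrite sumr_const card_ord -[leLHS]mulr_natl.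
Qed.

(** The quadratic terms cancel: |q j| + a <= |x j| + 1, and the cross term 2 |x j| is at most 2 n.
    The loss against the weight is therefore linear in n. *)
Lemma local_growth a n k q x : 0 < a <= 2^-1 -> 0 < k -> (0 < n)%N ->
  (forall j, `|q j| <= n%:R * (a / 88)) ->
  (forall j, `|x j 0 - q j| <= a / 88) ->
  \sum_(j < d) (`|q j| + a) ^+ 2 / 4 <=
  \sum_(j < d) (x j 0 ^+ 2 / 4 - k * `|x j 0|) + n%:R * (d%:R * (3 + 2 * k)).
Proof.
move=> a01 k0 n0 qn xq; have n1 : 1 <= n%:R :> R by rewrite ler1n.
have -> : n%:R * (d%:R * (3 + 2 * k)) = \sum_(j < d) (n%:R * (3 + 2 * k)) :> R.
  by rewrite sumr_const card_ord -[RHS]mulr_natl; ring.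
rewrite -big_split/=; apply: ler_sum => j _.
have q0 := normr_ge0 (q j); have x0 := normr_ge0 (x j 0).
have na : n%:R * (a / 88) <= n%:R / 2 by rewrite ler_wpM2l//; lra.
have qx : `|q j| <= `|x j 0| + a / 88.
  have := ler_normB (x j 0) (x j 0 - q j); have -> : x j 0 - (x j 0 - q j) = q j by ring.
  by have := xq j; lra.
have xn : `|x j 0| <= n%:R.
  have := ler_normD (x j 0 - q j) (q j); rewrite subrK.
  by have := xq j; have := qn j; lra.
have h1 : (`|q j| + a) ^+ 2 <= (`|x j 0| + 1) ^+ 2 by rewrite ler_sqr ?nnegrE; lra.
have h2 : (`|x j 0| + 1) ^+ 2 = x j 0 ^+ 2 + 2 * `|x j 0| + 1.
  by rewrite sqrrD real_normK ?num_real//; ring.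
have h3 : k * `|x j 0| <= k * n%:R by rewrite ler_wpM2l// ltW.
have h4 : 0 <= k * n%:R by rewrite mulr_ge0// ltW.
lra.
Qed.

Variables (a k B : R) (tau : 'I_d -> R) (F : 'cV[Cplx R]_d -> Cplx R) (f : 'cV[R]_d -> R).
Hypotheses (hd : (0 < d)%N) (a01 : 0 < a <= 2^-1) (k0 : 0 < k) (B0 : 0 <= B).
Hypotheses (atau : forall j, a < tau j) (hF : holomorphic_on (polystrip tau) F).
Hypothesis Ff : forall x : 'cV[R]_d, F (to_complex x) = (f x)%:C%C.
Hypothesis FB : forall z : 'cV[Cplx R]_d, polystrip tau z ->
  cmod (F z) <= B * expR (\sum_(j < d) (re_part z j 0) ^+ 2 / 4).
Hypothesis fB : forall x, `|f x| <= B * weight (2 * k) x.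

(** Where S differs from 1, some |x j| exceeds n a/88; half of the linear term 2 k |x j| gives the
    factor exp(- k (a/88) n), and the other half stays in the weight. *)
Lemma tail_estimate n x (S : R) : 0 <= S <= 1 ->
  ((forall j, `|x j 0| <= n%:R * (a / 88)) -> S = 1) ->
  `|(1 - S) * f x| <= B * expR (- (k * (a / 88) * n%:R)) * weight k x.
Proof.
move=> S01 S1; have [/forallP xn|/forallPn[j]] :=
    boolP [forall j, `|x j 0| <= n%:R * (a / 88)].
  rewrite S1// subrr mul0r normr0 !mulr_ge0 ?expR_ge0//.
rewrite -ltNge => xj; rewrite normrM; apply: (@le_trans _ _ (1 * `|f x|)).
  by rewrite ler_wpM2r// ler_norml; lra.
rewrite mul1r; apply: (le_trans (fB x)); rewrite -mulrA ler_wpM2l//.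
rewrite /weight -expRD ler_expR.
have -> : \sum_(j < d) (x j 0 ^+ 2 / 4 - 2 * k * `|x j 0|) =
    - (k * \sum_(j < d) `|x j 0|) + \sum_(j < d) (x j 0 ^+ 2 / 4 - k * `|x j 0|).
  by rewrite mulr_sumr -sumrN -big_split/=; apply: eq_bigr => i _; ring.
rewrite lerD2r lerN2 -mulrA ler_pM2l//.
have : `|x j 0| <= \sum_(i < d) `|x i 0|.
  by rewrite (bigD1 j)//= lerDl sumr_ge0.
by lra.
Qed.

Lemma network_rate : exists (A : R) (C : nat), 0 <= A /\ forall n, (0 < n)%N ->
  exists net : relu_net R 1 d,
  [/\ (net_depth net <= C * n ^ 3)%N, (net_size net <= C * n ^ (2 * d + 3))%N &
    forall x, `|f x - realize net x 0 0| <=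
      A * expR (- (k * (a / 88) * n%:R)) * weight k x].
Proof.
have a0 : 0 < a by case/andP: a01.
pose h := a / 88; have h0 : 0 < h by rewrite divr_gt0.
pose c := k * h; have c0 : 0 < c by rewrite mulr_gt0.
(* Degree K1 n gives 2^(- K1 n) <= exp(- K1 n / 2), which must beat the loss in [local_growth] and
   leave exp(- c n). *)
pose K1 := (Num.truncn (2 * (d%:R * (3 + 2 * k) + c))).+1.
(* In units of n^2, the exponent K2 pays 2d + 1 for the numbers of pieces and factors, d for the
   size of the coefficients, and c for the rate. *)
pose K2 := (Num.truncn (3 * d%:R + 1 + c)).+1.
have K1P : 2 * (d%:R * (3 + 2 * k) + c) <= K1%:R by exact/ltW/truncnS_gt.
have K2P : 3 * d%:R + 1 + c <= K2%:R by exact/ltW/truncnS_gt.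
pose P : nat := (3 ^ d * K1 ^ d * (d * (1 + K1)))%N.
pose A3 := P%:R * (10 ^+ d * B) * expR (d%:R * k ^+ 2).
pose C1 := (d * (1 + K1) * (K2 + 3) + 1)%N.
pose C2 := ((3 ^ d * K1 ^ d + 1) * ((C1 + 1) * layer_cost d))%N.
exists (B + 30 ^+ d * B + A3), (C1 + C2)%N; split.
  by rewrite !addr_ge0 ?mulr_ge0 ?exprn_ge0 ?expR_ge0.
move=> n n0; have n1 : 1 <= n%:R :> R by rewrite ler1n.
pose D := (K1 * n)%N; pose s := (K2 * n ^ 2)%N; pose j0 : 'I_d := Ordinal hd.
pose q (Q : {ffun 'I_d -> 'I_(2 * n + 1)}) := centre d h n Q.
pose M Q := B * expR (\sum_(j < d) (`|q Q j| + a) ^+ 2 / 4).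
have qn Q j : `|q Q j| <= n%:R * h by apply: centre_bound; exact: ltW.
have /choice[L HL] := fun Q =>
  local_approximation d a tau F f B (q Q) D a0 atau B0 hF Ff FB.
have M0 Q : 0 <= M Q by rewrite mulr_ge0 ?expR_ge0.
have sizeL Q : (size (L Q) <= D ^ d)%N by have [] := HL Q.
have [net [dn sn rn]] := assembled_net d j0 a n (d * D) s (D ^ d) L sizeL.
have nD : (d + d * D <= d * (1 + K1) * n)%N by exact: factor_count.
have depth : (((d + d * D) * (s + 3)).+1 <= C1 * n ^ 3)%N by exact: depth_count.
have volume : ((2 * n + 1) ^ d * D ^ d <= 3 ^ d * K1 ^ d * (n ^ d * n ^ d))%N.
  exact: volume_count.
exists net; split.
- by rewrite dn (leq_trans depth)// leq_mul2r leq_addr orbT.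
- apply: (leq_trans sn); apply: (@leq_trans (C2 * n ^ (2 * d + 3))); last first.
    by rewrite leq_mul2r leq_addl orbT.
  have n2d : (0 < n ^ (2 * d))%N by rewrite expn_gt0 n0.
  have h1 : (((2 * n + 1) ^ d * D ^ d).+1 <= (3 ^ d * K1 ^ d + 1) * n ^ (2 * d))%N.
    have n2E : (n ^ (2 * d) = n ^ d * n ^ d)%N by rewrite mul2n -addnn expnD.
    rewrite n2E in n2d *; rewrite [leqRHS]mulnDl mul1n -addn1.
    exact: leq_add volume n2d.
  have h2 : (((d + d * D) * (s + 3)).+2 <= (C1 + 1) * n ^ 3)%N.
    rewrite [leqRHS]mulnDl mul1n -[leqLHS]addn1; apply: leq_add depth _.
    by rewrite expn_gt0 n0.
  have := leq_mul h1 (leq_mul h2 (leqnn (layer_cost d))).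
  rewrite /C2 expnD; move: (n ^ (2 * d))%N (n ^ 3)%N => u v.
  by move=> /leq_trans; apply; apply: eq_leq; ring.
move=> x; rewrite rn.
pose S Q := \sum_(p <- L Q) p.1 * newton_monomial a (displacement d (q Q) x) p.2.
pose H Q := tensor_hat d h n Q x.
have H0 Q : 0 <= H Q by exact: tensor_hat_ge0.
(* Three errors: truncation to the cubes, interpolation on the cubes, and multiplication by
   networks. *)
have -> : f x - \sum_(u <- pieces d n L) piece_net d j0 a n (d * D) s u x =
    (1 - \sum_Q H Q) * f x + \sum_Q H Q * (f x - S Q) +
    (\sum_Q H Q * S Q - \sum_(u <- pieces d n L) piece_net d j0 a n (d * D) s u x).
  have -> : \sum_Q H Q * (f x - S Q) = (\sum_Q H Q) * f x - \sum_Q H Q * S Q.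
    by rewrite mulr_suml -sumrB; apply: eq_bigr => Q _; rewrite mulrBr.
  by ring.
have W0 : 0 <= weight k x by exact: expR_ge0.
set E := expR (- (k * (a / 88) * n%:R)).
have E0 : 0 <= E by exact: expR_ge0.
rewrite [(_ + A3) * E]mulrDl [leRHS]mulrDl [(_ + _) * E]mulrDl [X in _ <= X + _]mulrDl.
apply: (le_trans (ler_normD _ _)); apply: lerD; first apply: (le_trans (ler_normD _ _)); first apply: lerD.
- apply: tail_estimate; last exact: tensor_hat_sum_eq1.
  by rewrite sumr_ge0//= tensor_hat_sum_le1.
- apply: (le_trans (ler_norm_sum _ _ _)).
  apply: (@le_trans _ _ (\sum_Q H Q * (30 ^+ d * B * E * weight k x))); last first.
    rewrite -mulr_suml ler_piMl ?tensor_hat_sum_le1// !mulr_ge0 ?exprn_ge0//.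
  apply: ler_sum => Q _; rewrite normrM (ger0_norm (H0 Q)).
  have [->|HQ] := eqVneq (H Q) 0; first by rewrite !mul0r.
  have xq := tensor_hat_support d h n Q x h0 HQ.
  apply: ler_wpM2l => //; have [_ _ /(_ x xq)] := HL Q; move=> /le_trans; apply.
  set u := expR _; set v := _ ^+ D.
  have -> : 30 ^+ d * (B * u) * v = 30 ^+ d * B * (u * v) by ring.
  have -> : 30 ^+ d * B * E * weight k x = 30 ^+ d * B * (E * weight k x) by ring.
  rewrite ler_wpM2l ?mulr_ge0 ?exprn_ge0//.
  apply: (@le_trans _ _ (u * expR (- (D%:R / 2)))).
    by rewrite ler_wpM2l ?expR_ge0// half_exp_le.
  rewrite /E /weight /u -!expRD ler_expR.
  have := @local_growth a n k (q Q) x a01 k0 n0 (qn Q) xq.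
  rewrite /D natrM -/h -/c; have : n%:R * (2 * (d%:R * (3 + 2 * k) + c)) <= n%:R * K1%:R.
    by rewrite ler_wpM2l.
  by lra.
rewrite distrC; have LP Q p : p \in L Q -> [/\ `|p.1| <= 10 ^+ d * (B * expR (d%:R * n%:R ^+ 2)),
    (size p.2 <= d * D)%N &
    forall r, r \in p.2 -> (r.1 < d)%N && (`|r.2| <= a / 88)].
  have [_ HQ _] := HL Q; move=> /HQ[h1 h2 h3]; split=> //.
  apply: (le_trans h1); rewrite ler_wpM2l ?exprn_ge0// ler_wpM2l// ler_expR.
  exact: centre_growth.
have cc0 : 0 <= 10 ^+ d * (B * expR (d%:R * n%:R ^+ 2)).
  by rewrite !mulr_ge0 ?exprn_ge0 ?expR_ge0.
apply: (le_trans (assembled_error d j0 a n (d * D) s (D ^ d) L sizeL _ x a0 cc0 LP)).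
rewrite -/E; set T := 10 ^+ d * B.
have T0 : 0 <= T by rewrite mulr_ge0 ?exprn_ge0.
(* Powers of n are crudely bounded by exponentials of n^2, which the accuracy of the products has to
   beat in any case. *)
have count : ((2 * n + 1) ^ d * D ^ d)%:R * (d + d * D)%:R <=
    P%:R * expR ((2 * d + 1)%:R * (n ^ 2)%:R) :> R.
  apply: (@le_trans _ _ (P * n ^ (2 * d + 1))%:R).
    rewrite -natrM ler_nat (_ : (P * n ^ (2 * d + 1) =
      3 ^ d * K1 ^ d * (n ^ d * n ^ d) * (d * (1 + K1) * n))%N).
      exact: leq_mul volume nD.
    by rewrite /P expnD expn1 mul2n -addnn expnD; ring.
  rewrite natrM natrX ler_wpM2l// expRM_natl lerXn2r ?nnegrE ?expR_ge0//.
  exact: nat_le_exp_sqr.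
have decay : (4^-1 : R) ^+ s <= expR (- (K2%:R * (n ^ 2)%:R)).
  by rewrite -natrM; exact: quarter_exp_le.
apply: (@le_trans _ _ (P%:R * T * expR (- (c * n%:R)))); last first.
  rewrite /A3 -/T /E -/h -/c; set u := expR (- (c * _)); set v := expR (d%:R * _).
  have -> : P%:R * T * v * u * weight k x = P%:R * T * u * (v * weight k x) by ring.
  rewrite -[leLHS]mulr1 ler_wpM2l ?mulr_ge0 ?expR_ge0//.
  apply: (@le_trans _ _ (v * expR (- (d%:R * k ^+ 2)))).
    by rewrite -expRD subrr expR0.
  by rewrite ler_wpM2l ?expR_ge0// weight_ge.
have -> : ((2 * n + 1) ^ d * D ^ d)%:R * (10 ^+ d * (B * expR (d%:R * n%:R ^+ 2)) *
    ((d + d * D)%:R * 4^-1 ^+ s)) = T * (expR (d%:R * n%:R ^+ 2) *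
  (((2 * n + 1) ^ d * D ^ d)%:R * (d + d * D)%:R * 4^-1 ^+ s)) by rewrite /T; ring.
have -> : P%:R * T * expR (- (c * n%:R)) = T * (P%:R * expR (- (c * n%:R))) by ring.
apply: ler_wpM2l => //.
have step := ler_pM (mulr_ge0 (ler0n _ _) (ler0n _ _)) _ count decay.
apply: (le_trans (ler_wpM2l (expR_ge0 _) (step _))).
  by rewrite exprn_ge0// invr_ge0.
set u := expR (d%:R * _); set v := expR (_ * _); set w := expR (- (K2%:R * _)).
have -> : u * (P%:R * v * w) = P%:R * (u * v * w) by ring.
rewrite ler_wpM2l// /u /v /w -!expRD ler_expR natrD natrM natrX.
have : n%:R * 1 <= n%:R * n%:R :> R by rewrite ler_wpM2l.
rewrite -expr2 => nn; have n20 : 0 <= n%:R ^+ 2 :> R by rewrite exprn_ge0.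
have h1 : (3 * d%:R + 1 + c) * n%:R ^+ 2 <= K2%:R * n%:R ^+ 2 by rewrite ler_wpM2r.
have h2 : c * (n%:R * 1) <= c * n%:R ^+ 2 by rewrite ler_wpM2l// ltW.
lra.
Qed.

End rate.

(** All factors of the product are at most 1, so it lies below each of them; this stands in for a
    minimum over the coordinates. *)
Lemma positive_lower_bound (R : realType) d (tau : 'I_d -> R) :
  (forall j, 0 < tau j) -> exists b, 0 < b <= 1 /\ forall j, b <= tau j.
Proof.
move=> tau0; have m01 j : 0 <= Num.min 1 (tau j) <= 1.
  by rewrite le_min ler01 ltW//= ge_min lexx.
exists (\prod_j Num.min 1 (tau j)); split=> [|j].
  by rewrite prodr_gt0 ?prodr_ile1// => j _; rewrite lt_min ltr01/=.
rewrite (bigD1 j)//=; apply: (@le_trans _ _ (Num.min 1 (tau j))).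
  rewrite ler_piMr//; first by case/andP: (m01 j).
  by apply: prodr_ile1 => i _; exact: m01.
by rewrite ge_min lexx orbT.
Qed.

Section growth.
Context {R : realType} (d : nat).
Variables (tau : 'I_d -> R) (F : 'cV[Cplx R]_d -> Cplx R) (B : R).
Hypothesis tau0 : forall j, 0 < tau j.
Hypothesis B0 : 0 < B.
Hypothesis hB : forall z : 'cV[Cplx R]_d, polystrip tau z ->
  let x := re_part z in
  let y := im_part z in
  `|F z| <= (B * expR (\sum_(j < d)
    (x j 0 ^+ 2 / 4 - (Num.sqrt 2)^-1 * `|x j 0| *
       Num.sqrt (tau j ^+ 2 - y j 0 ^+ 2 / 2))))%:C%C.

Lemma growth_polystrip z : polystrip tau z ->
  cmod (F z) <= B * expR (\sum_(j < d) (re_part z j 0) ^+ 2 / 4).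
Proof.
move=> /hB; rewrite /= normC_cmod lecR => /le_trans; apply.
rewrite ler_pM2l// ler_expR; apply: ler_sum => j _.
by rewrite gerBl !mulr_ge0 ?invr_ge0 ?sqrtr_ge0.
Qed.

(** At y = 0 the square root equals tau j, so f decays linearly at rate at least b / sqrt 2 relative
    to exp(x^2/4). *)
Lemma growth_real (f : 'cV[R]_d -> R) b :
  (forall x : 'cV[R]_d, F (to_complex x) = (f x)%:C%C) -> 0 < b ->
  (forall j, b <= tau j) ->
  forall x, `|f x| <= B * weight d (2 * ((Num.sqrt 2)^-1 * b / 2)) x.
Proof.
move=> Ff b0 btau x; have : polystrip tau (to_complex x).
  by move=> j; rewrite /strip/= mxE normr0.
move=> /hB; rewrite /= normC_cmod lecR Ff cmod_real => /le_trans; apply.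
rewrite ler_pM2l// ler_expR; apply: ler_sum => j _; rewrite !mxE /=.
rewrite lerD2l lerN2 expr0n mul0r subr0 sqrtr_sqr (gtr0_norm (tau0 j)).
have -> : 2 * ((Num.sqrt 2)^-1 * b / 2) * `|x j 0| = (Num.sqrt 2)^-1 * `|x j 0| * b :> R.
  by field; rewrite gt_eqF// sqrtr_gt0.
by rewrite ler_wpM2l// mulr_ge0// invr_ge0 sqrtr_ge0.
Qed.

End growth.

Theorem theorem4p7 (R : realType) (d : nat) (hd : (0 < d)%N)
    (tau : 'I_d -> R) (htau : forall j, 0 < tau j)
    (f : 'cV[R]_d -> R) (F : 'cV[Cplx R]_d -> Cplx R)
    (hF : holomorphic_on (polystrip tau) F)
    (hFf : forall x : 'cV[R]_d, F (to_complex x) = (f x)%:C%C)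
    (hbound : forall beta : 'I_d -> R, (forall j, 0 <= beta j <= tau j) ->
      exists B : R, 0 < B /\
        forall z : 'cV[Cplx R]_d, polystrip beta z ->
          let x := re_part z in
          let y := im_part z in
          `|F z| <= (B * expR (\sum_(j < d)
            (x j 0 ^+ 2 / 4 - (Num.sqrt 2)^-1 * `|x j 0| *
               Num.sqrt (beta j ^+ 2 - y j 0 ^+ 2 / 2))))%:C%C) :
  forall beta : 'I_d -> R, (forall j, 0 < beta j < tau j) ->
  exists C : R, 0 < C /\
    forall N : nat, (0 < N)%N ->
    exists net : relu_net R 1 d,
      [/\ (net_size net)%:R <= C * N%:R * (1 + ln N%:R),
          (net_depth net)%:R <=
            C * N%:R `^ (3 / (2 * d + 7)%:R) * (1 + ln N%:R) ^+ 2 &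
          (gaussian_L2 (fun x => (f x - realize net x 0 0)%R) <=
            (C * expR (- ((Num.sqrt 2)^-1 * geometric_mean beta *
               N%:R `^ ((2 * d + 7)%:R^-1))))%:E)%E].
Proof.
move=> beta _; have [b [/andP[b0 b1] btau]] := positive_lower_bound R d tau htau.
have [B [B0 hB]] := hbound tau (fun j => introT andP (conj (ltW (htau j)) (lexx _))).
(* Halving makes a < tau j strict; b <= 1 gives a <= 1/2. *)
pose a := b / 2; have a01 : 0 < a <= 2^-1 by rewrite /a; apply/andP; split; lra.
have atau j : a < tau j by apply: lt_le_trans (btau j); rewrite /a; lra.
(* Half of the decay rate of f on the reals; the other half is spent in [tail_estimate]. *)
pose k := (Num.sqrt 2)^-1 * b / 2.
have k0 : 0 < k by rewrite /k !mulr_gt0 ?invr_gt0 ?sqrtr_gt0.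
have [A [C [A0 rate]]] := network_rate d a k B tau F f hd a01 k0 (ltW B0) atau hF hFf
  (growth_polystrip d tau F B B0 hB) (growth_real d tau F B htau B0 hB f b hFf b0 btau).
have [K [K0 gK]] := gaussian_L2_le d k k0.
pose c := k * (a / 88); have c0 : 0 < c by rewrite mulr_gt0// divr_gt0//; case/andP: a01.
pose delta := (Num.sqrt 2)^-1 * geometric_mean beta.
have delta0 : 0 <= delta by rewrite mulr_ge0 ?invr_ge0 ?sqrtr_ge0// powR_ge0.
(* With t = N^(1/(2d+7)) and n just above lam * t, c n >= delta t is the prescribed exponent, while
   n <= (lam + 1) t bounds n^3 and n^(2d+7) by constants times t^3 and N. *)
pose lam := delta / c; have lam0 : 0 <= lam by rewrite divr_ge0// ltW.
pose C3 := C%:R * (lam + 1) ^+ 3; pose C7 := C%:R * (lam + 1) ^+ (2 * d + 7).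
have C30 : 0 <= C3 by rewrite mulr_ge0// exprn_ge0// addr_ge0.
have C70 : 0 <= C7 by rewrite mulr_ge0// exprn_ge0// addr_ge0.
have AK0 : 0 <= A * K by rewrite mulr_ge0.
exists (C3 + C7 + A * K + 1); split; first lra.
move=> N N0; have N1 : 1 <= N%:R :> R by rewrite ler1n.
set e : R := (2 * d + 7)%:R^-1; pose t : R := N%:R `^ e.
have e0 : 0 < e by rewrite invr_gt0 ltr0n addnC.
have t1 : 1 <= t by rewrite -(powRr0 N%:R) ler_powR// ltW.
have tX p : t ^+ p = N%:R `^ (p%:R * e) by rewrite -powR_mulrn ?powR_ge0// -powRrM mulrC.
have tN : t ^+ (2 * d + 7) = N%:R.
  by rewrite tX mulfV ?powRr1 ?ler0n// pnatr_eq0 addnC.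
pose n := (Num.truncn (lam * t)).+1.
have nlam : lam * t <= n%:R by exact/ltW/truncnS_gt.
have nle : n%:R <= (lam + 1) * t.
  rewrite /n -natr1 mulrDl mul1r lerD//.
  by rewrite truncn_le mulr_ge0//; lra.
have nX p : (n ^ p)%:R <= (lam + 1) ^+ p * t ^+ p.
  by rewrite natrX -exprMn lerXn2r ?nnegrE ?mulr_ge0//; lra.
have ln0 : 0 <= ln N%:R :> R by exact: ln_ge0.
have [net [dn sn en]] := rate n isT; exists net; split.
- have h : (net_size net)%:R <= C7 * N%:R.
    apply: (@le_trans _ _ (C * n ^ (2 * d + 7))%:R).
      rewrite ler_nat (leq_trans sn)// leq_mul2l leq_pexp2l ?orbT//.
      by rewrite leq_add2l.
    by rewrite natrM /C7 -tN -mulrA ler_wpM2l.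
  apply: (le_trans h); rewrite -mulrA; apply: ler_pM => //; first lra.
  by rewrite ler_peMr//; lra.
- have h : (net_depth net)%:R <= C3 * N%:R `^ (3 / (2 * d + 7)%:R).
    apply: (@le_trans _ _ (C * n ^ 3)%:R); first by rewrite ler_nat.
    by rewrite natrM /C3 -tX -mulrA ler_wpM2l.
  apply: (le_trans h); rewrite -mulrA; apply: ler_pM; rewrite ?powR_ge0//; first lra.
  by rewrite ler_peMr ?powR_ge0// exprn_ege1//; lra.
- have E0 : 0 <= A * expR (- (c * n%:R)) by rewrite mulr_ge0 ?expR_ge0.
  apply: (le_trans (gK _ (fun x => f x - realize net x 0 0) E0 en)).
  rewrite lee_fin mulrAC; apply: ler_pM; rewrite ?expR_ge0//; first lra.
  rewrite ler_expR lerN2; apply: (@le_trans _ _ (c * (lam * t))).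
    by rewrite /lam mulrA [c * _]mulrC divfK// gt_eqF.
  by rewrite ler_pM2l.
Qed.
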